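(* Let $\prec$ be any binary relation on terms such that, for all terms $r,s$, $r\prec s$ entails $s\not\prec r$. Any derivation in $LJ^{=}_{12}$ or $LK^{=}_{12}$ can be transformed into a cut-free semishortening (with respect to $\prec$) derivation in the same calculus of its endsequent.
   Context: The language is first-order with equality and function symbols; free and bound object variables are syntactically distinct, and terms contain only free variables. A sequent $\Gamma\Rightarrow\Delta$ consists of two finite sequences of formulae. $F\{v/t\}$ is the result of simultaneously replacing all occurrences of the free object variable $v$ in $F$ by the term $t$. $LK$ is Gentzen's classical sequent calculus: logical axioms $F\Rightarrow F$ for every formula $F$; the structural rules of left and right weakening, exchange and contraction, and the cut rule (from $\Gamma\Rightarrow\Delta,F$ and $\Lambda,F\Rightarrow\Theta$ infer $\Gamma,\Lambda\Rightarrow\Delta,\Theta$); and the usual left and right logical rules for $\neg,\wedge,\vee,\to,\forall,\exists$, where the left rule for $\forall$ and the right rule for $\exists$ may be instantiated with an arbitrary term. $LJ$ is Gentzen's intuitionistic calculus, in which all sequents have at most one formula in the succedent. $LJ^{=}_{12}$ and $LK^{=}_{12}$ are obtained from $LJ$ and $LK$ by adding the Reflexivity Axiom $\Rightarrow t=t$ (for every term $t$) and the four equality rules ($F$ any formula, $r,s$ terms, $v$ a free object variable occurring neither in $r$ nor in $s$): $(=_1)$: from $\Gamma\Rightarrow\Delta,F\{v/r\}$ infer $\Gamma,r=s\Rightarrow\Delta,F\{v/s\}$; $(=_2)$: from $\Gamma\Rightarrow\Delta,F\{v/r\}$ infer $\Gamma,s=r\Rightarrow\Delta,F\{v/s\}$;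 $(=_1^l)$: from $\Gamma,F\{v/r\}\Rightarrow\Delta$ infer $\Gamma,F\{v/s\},r=s\Rightarrow\Delta$; $(=_2^l)$: from $\Gamma,F\{v/r\}\Rightarrow\Delta$ infer $\Gamma,F\{v/s\},s=r\Rightarrow\Delta$. In $LJ^{=}_{12}$, $\Delta=\emptyset$ in $=_1,=_2$ and $|\Delta|\le1$ in $=_1^l,=_2^l$. An application of one of these equality rules, with premiss $\Gamma\Rightarrow\Delta,F\{v/r\}$ and conclusion $\Gamma,r=s\Rightarrow\Delta,F\{v/s\}$ in the case of $=_1$, or $\Gamma,s=r\Rightarrow\Delta,F\{v/s\}$ in the case of $=_2$, and with premiss $\Gamma,F\{v/r\}\Rightarrow\Delta$ and conclusion $\Gamma,F\{v/s\},r=s\Rightarrow\Delta$ in the case of $=_1^l$, or $\Gamma,F\{v/s\},s=r\Rightarrow\Delta$ in the case of $=_2^l$ (replacing $r$ in the premiss by $s$ in the conclusion), is nonlengthening if $s\not\prec r$, and shortening if $r\prec s$. A derivation is nonlengthening if all its equality inferences are nonlengthening; it is semishortening if it is nonlengthening and, furthermore, all its $=_1$- and $=_1^l$-inferences are shortening. *)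

(* Defs.v *)
From mathcomp Require Import all_boot.

Set Implicit Arguments.
Unset Strict Implicit.
Unset Printing Implicit Defensive.

(** * Language

    Free object variables are named by natural numbers.  Bound object variables
    form a separate sort and are de Bruijn indices, so formulae are identified
    up to renaming of bound variables.  [term L n] and [formula L n] may contain
    the [n] dangling bound variables ['I_n]; the terms and formulae of the
    language are [term L 0] and [formula L 0].  In particular a term contains
    free variables only. *)

Record language := Language {
  fun_symbol : Type;
  fun_arity : fun_symbol -> nat;
  rel_symbol : Type;
  rel_arity : rel_symbol -> nat
}.

Inductive term (L : language) (n : nat) : Type :=
| Free of nat
| Bound of 'I_n
| App (f : fun_symbol L) of ('I_(fun_arity f) -> term L n).

Arguments Free {L n}.
Arguments Bound {L n}.
Arguments App {L n}.

Inductive formula (L : language) (n : nat) : Type :=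
| Rel (p : rel_symbol L) of ('I_(rel_arity p) -> term L n)
| Eq of term L n & term L n
| Not of formula L n
| And of formula L n & formula L n
| Or of formula L n & formula L n
| Imp of formula L n & formula L n
| All of formula L n.+1
| Ex of formula L n.+1.

Arguments Rel {L n}.

(** * Substitution for bound variables *)

Fixpoint tbind L m n (sigma : 'I_m -> term L n) (t : term L m) : term L n :=
  match t with
  | Free v => Free v
  | Bound i => sigma i
  | App f ts => App f (fun i => tbind sigma (ts i))
  end.

Definition up L m n (sigma : 'I_m -> term L n) : 'I_m.+1 -> term L n.+1 :=
  fun i => if unlift ord0 i is Some j
           then tbind (fun k => Bound (lift ord0 k)) (sigma j)
           else Bound ord0.

Fixpoint fbind L m n (sigma : 'I_m -> term L n) (A : formula L m) :
    formula L n :=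
  match A with
  | Rel p ts => Rel p (fun i => tbind sigma (ts i))
  | Eq t u => Eq (tbind sigma t) (tbind sigma u)
  | Not B => Not (fbind sigma B)
  | And B C => And (fbind sigma B) (fbind sigma C)
  | Or B C => Or (fbind sigma B) (fbind sigma C)
  | Imp B C => Imp (fbind sigma B) (fbind sigma C)
  | All B => All (fbind (up sigma) B)
  | Ex B => Ex (fbind (up sigma) B)
  end.

(** The instance by [t] of the body [A] of a quantified formula. *)
Definition inst L (A : formula L 1) (t : term L 0) : formula L 0 :=
  fbind (fun=> t) A.

(** * Substitution for free variables

    The substituted term has no dangling bound variable, hence it is not
    shifted under quantifiers and capture cannot occur. *)

Definition weaken L n (t : term L 0) : term L n :=
  tbind (fun i => Bound (widen_ord (leq0n n) i)) t.

Fixpoint tsubst L (v : nat) (t : term L 0) n (u : term L n) : term L n :=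
  match u with
  | Free w => if w == v then weaken n t else Free w
  | Bound i => Bound i
  | App f us => App f (fun i => tsubst v t (us i))
  end.

Fixpoint fsubst L (v : nat) (t : term L 0) n (A : formula L n) : formula L n :=
  match A with
  | Rel p us => Rel p (fun i => tsubst v t (us i))
  | Eq u w => Eq (tsubst v t u) (tsubst v t w)
  | Not B => Not (fsubst v t B)
  | And B C => And (fsubst v t B) (fsubst v t C)
  | Or B C => Or (fsubst v t B) (fsubst v t C)
  | Imp B C => Imp (fsubst v t B) (fsubst v t C)
  | All B => All (fsubst v t B)
  | Ex B => Ex (fsubst v t B)
  end.

Notation "F {{ v / t }}" := (fsubst v t F)
  (at level 2, v at level 39, left associativity, format "F {{ v / t }}").

(** * Occurrences of free variables *)

Fixpoint toccurs L (v : nat) n (t : term L n) : Prop :=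
  match t with
  | Free w => w = v
  | Bound _ => False
  | App f ts => exists i, toccurs v (ts i)
  end.

Fixpoint foccurs L (v : nat) n (A : formula L n) : Prop :=
  match A with
  | Rel p ts => exists i, toccurs v (ts i)
  | Eq t u => toccurs v t \/ toccurs v u
  | Not B => foccurs v B
  | And B C => foccurs v B \/ foccurs v C
  | Or B C => foccurs v B \/ foccurs v C
  | Imp B C => foccurs v B \/ foccurs v C
  | All B => foccurs v B
  | Ex B => foccurs v B
  end.

(** * Sequents and derivations *)

Record sequent (L : language) := Sequent {
  antecedent : seq (formula L 0);
  succedent : seq (formula L 0)
}.

Notation "Γ ⇒ Δ" := (Sequent Γ Δ) (at level 70, no associativity).

Fixpoint soccurs L (v : nat) (Γ : seq (formula L 0)) : Prop :=
  if Γ is A :: Γ' then foccurs v A \/ soccurs v Γ' else False.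

Definition eigenvariable L (a : nat) (S : sequent L) : Prop :=
  ~ soccurs a (antecedent S) /\ ~ soccurs a (succedent S).

(** Derivation trees of LK with the Reflexivity Axiom and the four equality
    rules.  The eigenvariable of [AllR] and [ExL] does not occur in the
    conclusion. *)
Inductive derivation (L : language) : sequent L -> Type :=
| Ax F : derivation ([:: F] ⇒ [:: F])
| Refl t : derivation ([::] ⇒ [:: Eq t t])
| WeakL Γ Δ F : derivation (Γ ⇒ Δ) -> derivation (Γ ++ [:: F] ⇒ Δ)
| WeakR Γ Δ F : derivation (Γ ⇒ Δ) -> derivation (Γ ⇒ Δ ++ [:: F])
| ExchL Γ Λ Δ F G :
    derivation (Γ ++ F :: G :: Λ ⇒ Δ) -> derivation (Γ ++ G :: F :: Λ ⇒ Δ)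
| ExchR Γ Δ Θ F G :
    derivation (Γ ⇒ Δ ++ F :: G :: Θ) -> derivation (Γ ⇒ Δ ++ G :: F :: Θ)
| ContrL Γ Δ F :
    derivation (Γ ++ [:: F; F] ⇒ Δ) -> derivation (Γ ++ [:: F] ⇒ Δ)
| ContrR Γ Δ F :
    derivation (Γ ⇒ Δ ++ [:: F; F]) -> derivation (Γ ⇒ Δ ++ [:: F])
| Cut Γ Λ Δ Θ F :
    derivation (Γ ⇒ Δ ++ [:: F]) -> derivation (Λ ++ [:: F] ⇒ Θ) ->
    derivation (Γ ++ Λ ⇒ Δ ++ Θ)
| NotL Γ Δ A :
    derivation (Γ ⇒ Δ ++ [:: A]) -> derivation (Γ ++ [:: Not A] ⇒ Δ)
| NotR Γ Δ A :
    derivation (Γ ++ [:: A] ⇒ Δ) -> derivation (Γ ⇒ Δ ++ [:: Not A])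
| AndL1 Γ Δ A B :
    derivation (Γ ++ [:: A] ⇒ Δ) -> derivation (Γ ++ [:: And A B] ⇒ Δ)
| AndL2 Γ Δ A B :
    derivation (Γ ++ [:: B] ⇒ Δ) -> derivation (Γ ++ [:: And A B] ⇒ Δ)
| AndR Γ Δ A B :
    derivation (Γ ⇒ Δ ++ [:: A]) -> derivation (Γ ⇒ Δ ++ [:: B]) ->
    derivation (Γ ⇒ Δ ++ [:: And A B])
| OrL Γ Δ A B :
    derivation (Γ ++ [:: A] ⇒ Δ) -> derivation (Γ ++ [:: B] ⇒ Δ) ->
    derivation (Γ ++ [:: Or A B] ⇒ Δ)
| OrR1 Γ Δ A B :
    derivation (Γ ⇒ Δ ++ [:: A]) -> derivation (Γ ⇒ Δ ++ [:: Or A B])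
| OrR2 Γ Δ A B :
    derivation (Γ ⇒ Δ ++ [:: B]) -> derivation (Γ ⇒ Δ ++ [:: Or A B])
| ImpL Γ Λ Δ Θ A B :
    derivation (Γ ⇒ Δ ++ [:: A]) -> derivation (Λ ++ [:: B] ⇒ Θ) ->
    derivation (Γ ++ Λ ++ [:: Imp A B] ⇒ Δ ++ Θ)
| ImpR Γ Δ A B :
    derivation (Γ ++ [:: A] ⇒ Δ ++ [:: B]) ->
    derivation (Γ ⇒ Δ ++ [:: Imp A B])
| AllL Γ Δ (A : formula L 1) (t : term L 0) :
    derivation (Γ ++ [:: inst A t] ⇒ Δ) -> derivation (Γ ++ [:: All A] ⇒ Δ)
| AllR Γ Δ (A : formula L 1) (a : nat) :
    eigenvariable a (Γ ⇒ Δ ++ [:: All A]) ->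
    derivation (Γ ⇒ Δ ++ [:: inst A (Free a)]) ->
    derivation (Γ ⇒ Δ ++ [:: All A])
| ExL Γ Δ (A : formula L 1) (a : nat) :
    eigenvariable a (Γ ++ [:: Ex A] ⇒ Δ) ->
    derivation (Γ ++ [:: inst A (Free a)] ⇒ Δ) ->
    derivation (Γ ++ [:: Ex A] ⇒ Δ)
| ExR Γ Δ (A : formula L 1) (t : term L 0) :
    derivation (Γ ⇒ Δ ++ [:: inst A t]) -> derivation (Γ ⇒ Δ ++ [:: Ex A])
| Eq1 Γ Δ (F : formula L 0) (v : nat) (r s : term L 0) :
    ~ toccurs v r -> ~ toccurs v s ->
    derivation (Γ ⇒ Δ ++ [:: F{{v/r}}]) ->
    derivation (Γ ++ [:: Eq r s] ⇒ Δ ++ [:: F{{v/s}}])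
| Eq2 Γ Δ (F : formula L 0) (v : nat) (r s : term L 0) :
    ~ toccurs v r -> ~ toccurs v s ->
    derivation (Γ ⇒ Δ ++ [:: F{{v/r}}]) ->
    derivation (Γ ++ [:: Eq s r] ⇒ Δ ++ [:: F{{v/s}}])
| Eq1L Γ Δ (F : formula L 0) (v : nat) (r s : term L 0) :
    ~ toccurs v r -> ~ toccurs v s ->
    derivation (Γ ++ [:: F{{v/r}}] ⇒ Δ) ->
    derivation (Γ ++ [:: F{{v/s}}; Eq r s] ⇒ Δ)
| Eq2L Γ Δ (F : formula L 0) (v : nat) (r s : term L 0) :
    ~ toccurs v r -> ~ toccurs v s ->
    derivation (Γ ++ [:: F{{v/r}}] ⇒ Δ) ->
    derivation (Γ ++ [:: F{{v/s}}; Eq s r] ⇒ Δ).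

(** [P] holds of every subderivation of [d], including [d] itself; with [P]
    looking only at the last inference this says that every inference of [d]
    satisfies [P]. *)
Fixpoint everywhere L (P : forall S : sequent L, derivation S -> Prop)
    (S : sequent L) (d : derivation S) : Prop :=
  P S d /\
  match d with
  | Ax _ | Refl _ => True
  | WeakL _ _ _ e | WeakR _ _ _ e
  | ExchL _ _ _ _ _ e | ExchR _ _ _ _ _ e
  | ContrL _ _ _ e | ContrR _ _ _ e
  | NotL _ _ _ e | NotR _ _ _ e
  | AndL1 _ _ _ _ e | AndL2 _ _ _ _ e
  | OrR1 _ _ _ _ e | OrR2 _ _ _ _ e
  | ImpR _ _ _ _ e
  | AllL _ _ _ _ e | AllR _ _ _ _ _ e
  | ExL _ _ _ _ _ e | ExR _ _ _ _ e
  | Eq1 _ _ _ _ _ _ _ _ e | Eq2 _ _ _ _ _ _ _ _ e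
  | Eq1L _ _ _ _ _ _ _ _ e | Eq2L _ _ _ _ _ _ _ _ e => everywhere P e
  | Cut _ _ _ _ _ e1 e2
  | AndR _ _ _ _ e1 e2
  | OrL _ _ _ _ e1 e2
  | ImpL _ _ _ _ _ _ e1 e2 => everywhere P e1 /\ everywhere P e2
  end.

(** Gentzen's LJ is LK with every sequent restricted to at most one formula in
    the succedent; this yields the side conditions on [Δ] in all its rules
    (for instance [Δ] is empty in [Eq1], [Eq2], [NotL], [ImpL] and [Cut]). *)
Inductive calculus := LJeq12 | LKeq12.

Definition derivation_in (c : calculus) L (S : sequent L) (d : derivation S) :
    Prop :=
  match c with
  | LJeq12 => everywhere (fun S' _ => size (succedent S') <= 1) d
  | LKeq12 => True
  end.

Definition is_cut L (S : sequent L) (d : derivation S) : Prop :=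
  if d is Cut _ _ _ _ _ _ _ then True else False.

Definition cut_free L (S : sequent L) (d : derivation S) : Prop :=
  everywhere (fun S' d' => ~ is_cut d') d.

Section Shortening.

Context (L : language) (prec : term L 0 -> term L 0 -> Prop).

(** In all four equality rules [r] is the term replaced in the premiss and [s]
    the term replacing it in the conclusion. *)
Definition nonlengthening_last (S : sequent L) (d : derivation S) : Prop :=
  match d with
  | Eq1 _ _ _ _ r s _ _ _ | Eq2 _ _ _ _ r s _ _ _
  | Eq1L _ _ _ _ r s _ _ _ | Eq2L _ _ _ _ r s _ _ _ => ~ prec s r
  | _ => True
  end.

Definition shortening_Eq1_last (S : sequent L) (d : derivation S) : Prop :=
  match d with
  | Eq1 _ _ _ _ r s _ _ _ | Eq1L _ _ _ _ r s _ _ _ => prec r s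
  | _ => True
  end.

Definition nonlengthening (S : sequent L) (d : derivation S) : Prop :=
  everywhere nonlengthening_last d.

Definition semishortening (S : sequent L) (d : derivation S) : Prop :=
  nonlengthening d /\ everywhere shortening_Eq1_last d.

End Shortening.

(* Main.v *)
Require Import Defs.
From mathcomp Require Import all_boot.
From Stdlib Require Import FunctionalExtensionality Eqdep Classical_Prop.
From Stdlib Require Import Permutation.
From Stdlib Require List.

(** Orient every equation: the equality rules that a semishortening derivation
    may use allow, read from conclusion to premiss, to rewrite with [a = b]
    from [b] to [a] if [prec a b], and from [a] to [b] otherwise.  So exactly
    one direction is available for each equation, on both sides of the sequent,
    and asymmetry of [prec] makes the direction given by [prec a b]
    nonlengthening as well as shortening.  The theorem says that an arbitrary
    orientation of the equations, and no cut, suffice.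

    For sequents with atomic premisses and an atomic conclusion this is
    [derives_replace]: the missing direction is admissible.  Suppose that the
    last inference rewrote [s] to [r] and that [a = b] is to be used against
    its orientation.  If the two places are disjoint, the inferences commute.
    If [s] lies inside [a], then a rewriting on the left turns [a = b] into an
    equation [a' = b], where [a'] has [r] at the place of [s], and [a' = b]
    applies to the premiss, whatever its orientation.  If [a] lies inside [s],
    the equation between [s] and [r] is rewritten in the same way.  With both
    directions at hand, derivable equations are congruences ([derives_Eq]).

    Cuts are eliminated by a model, in the manner of Okada, which serves LJ and
    LK alike.  A formula denotes a set of sequents; the sets that occur are
    those determined by which further sequents complete all their members to
    derivable ones, where derivable means: by a cut-free semishortening
    derivation.  An atomic formula is interpreted by the sequents whose
    antecedent derives it in the atomic calculus.  The model is sound for all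
    rules, cut and the unrestricted equality rules included ([soundness]), and
    it is so built that a formula belongs to its own denotation when put in the
    antecedent, and that every member of the denotation becomes derivable when
    the formula is added to its succedent ([adequacy]).  Together these make
    every valid sequent derivable ([valid_provable]). *)

Set Implicit Arguments.
Unset Strict Implicit.
Unset Printing Implicit Defensive.

(** * Sequences up to inclusion *)

Section Lists.
Context (T : Type).
Implicit Types s t : seq T.

Lemma In_cat x s t : List.In x (s ++ t) <-> List.In x s \/ List.In x t.
Proof. exact: List.in_app_iff. Qed.

Lemma perm_catC s t : Permutation (s ++ t) (t ++ s).
Proof. exact: Permutation_app_comm. Qed.

Lemma In_perm x s : List.In x s -> exists t, Permutation s (t ++ [:: x]).
Proof.
move=> /(@List.in_split T) [s1 [s2 ->]]; exists (s1 ++ s2).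
exact: Permutation_trans (Permutation_sym (Permutation_middle s1 s2 x))
  (perm_catC [:: x] (s1 ++ s2)).
Qed.

End Lists.

Ltac solve_incl :=
  let x := fresh in
  move=> x; do 9?(rewrite In_cat); rewrite /= ?In_cat; tauto.

(** * Cut-free semishortening provability *)

Lemma everywhere_imp L (P Q : forall S : sequent L, derivation S -> Prop) :
  (forall S (d : derivation S), P S d -> Q S d) ->
  forall S (d : derivation S), everywhere P d -> everywhere Q d.
Proof.
move=> PQ S d; elim: d => /= *;
  repeat match goal with H : _ /\ _ |- _ => case: H => ?? end;
  by do ?split; auto.
Qed.

Lemma everywhere_last L (P : forall S : sequent L, derivation S -> Prop) S
    (d : derivation S) : everywhere P d -> P S d.
Proof. by case: d => /= > []. Qed.

Section Provable.
Context (L : language) (prec : term L 0 -> term L 0 -> Prop) (c : calculus).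
Implicit Types Γ Δ Λ : seq (formula L 0).

(** The size condition of the calculus on succedents. *)
Definition fits Δ := if c is LJeq12 then size Δ <= 1 else true.

(** In LK the condition holds trivially, which puts both calculi in the same
    form. *)
Lemma derivation_in_fits (S : sequent L) (d : derivation S) :
  derivation_in c d <-> everywhere (fun S' _ => fits (succedent S')) d.
Proof.
rewrite /derivation_in /fits; case: c => //; split=> // _.
by elim: d => /= *; do ?split.
Qed.

(** The requirements on the last inference of a derivation are collected in one
    predicate, so that a derivation is traversed only once. *)
Definition good_last (S : sequent L) (d : derivation S) :=
  [/\ fits (succedent S), ~ is_cut d, nonlengthening_last prec d
    & shortening_Eq1_last prec d].

Definition provable Γ Δ :=
  exists d : derivation (Γ ⇒ Δ), everywhere good_last d.

Lemma provable_derivation Γ Δ : provable Γ Δ ->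
  exists d : derivation (Γ ⇒ Δ),
    derivation_in c d /\ cut_free d /\ semishortening prec d.
Proof.
case=> d h; exists d; rewrite derivation_in_fits.
by do 3?split; apply: everywhere_imp h => {}S {}d [].
Qed.

Lemma provable_fits Γ Δ : provable Γ Δ -> fits Δ.
Proof. by case=> d /everywhere_last []. Qed.

Lemma fits_cat Δ Λ : fits (Δ ++ Λ) -> fits Δ /\ fits Λ.
Proof.
rewrite /fits; case: c => //; rewrite size_cat => h.
by split; apply: leq_trans h; [apply: leq_addr | apply: leq_addl].
Qed.

Lemma fits_catl Δ Λ : fits (Δ ++ Λ) -> fits Δ.
Proof. by case/fits_cat. Qed.

Lemma fits_rcons Δ A B : fits (Δ ++ [:: A]) -> fits (Δ ++ [:: B]).
Proof. by rewrite /fits; case: c => //; rewrite !size_cat. Qed.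

Lemma fits_rcons_cat Δ Θ A : fits (Δ ++ [:: A]) -> fits Θ -> fits (Δ ++ Θ).
Proof.
by rewrite /fits; case: c => //; rewrite !size_cat /= addn1; case: (size Δ).
Qed.

End Provable.

Ltac by_rule R :=
  exists R; do !(split=> //); rewrite /=;
  try match goal with p : provable _ _ _ _ |- _ =>
    first [ exact (provable_fits p) | exact (fits_catl (provable_fits p))
          | exact (fits_rcons _ (provable_fits p)) ]
  end.

Section Rules.
Context (L : language) (prec : term L 0 -> term L 0 -> Prop) (c : calculus).
Implicit Types Γ Δ Λ Θ : seq (formula L 0).

Local Notation provable := (provable prec c).
Local Notation fits := (@fits L c).

Lemma provable_Ax F : provable [:: F] [:: F].
Proof. by by_rule (Ax F); rewrite /fits; case: c. Qed.

Lemma provable_Refl t : provable [::] [:: Eq t t].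
Proof. by by_rule (Refl t); rewrite /fits; case: c. Qed.

Lemma provable_WeakL Γ Δ F : provable Γ Δ -> provable (Γ ++ [:: F]) Δ.
Proof. by move=> p; case: (p) => d h; by_rule (WeakL F d). Qed.

Lemma provable_WeakR Γ Δ F :
  fits (Δ ++ [:: F]) -> provable Γ Δ -> provable Γ (Δ ++ [:: F]).
Proof. by move=> f p; case: (p) => d h; by_rule (WeakR F d). Qed.

Lemma provable_ContrL Γ Δ F :
  provable (Γ ++ [:: F; F]) Δ -> provable (Γ ++ [:: F]) Δ.
Proof. by move=> p; case: (p) => d h; by_rule (ContrL d). Qed.

Lemma provable_ContrR Γ Δ F :
  provable Γ (Δ ++ [:: F; F]) -> provable Γ (Δ ++ [:: F]).
Proof.
move=> p; case: (p) => d h; by_rule (ContrR d).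
by have := provable_fits p; rewrite -cat_rcons -cats1; apply: fits_catl.
Qed.

Lemma provable_permL Γ Γ' Δ :
  Permutation Γ Γ' -> provable Γ Δ -> provable Γ' Δ.
Proof.
move=> pm; have: forall Λ, provable (Λ ++ Γ) Δ -> provable (Λ ++ Γ') Δ;
  last by move/(_ [::]).
elim: pm => //.
- by move=> F s t _ IH Λ; rewrite -!cat_rcons; apply: IH.
- by move=> F G s Λ p; case: (p) => d h; by_rule (ExchL d).
- by move=> s t u _ IH1 _ IH2 Λ /IH1; apply: IH2.
Qed.

Lemma fits_size Δ Δ' : size Δ = size Δ' -> fits Δ -> fits Δ'.
Proof. by rewrite /fits; case: c => // ->. Qed.

Lemma provable_permR Γ Δ Δ' :
  Permutation Δ Δ' -> provable Γ Δ -> provable Γ Δ'.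
Proof.
move=> pm; have: forall Λ, provable Γ (Λ ++ Δ) -> provable Γ (Λ ++ Δ');
  last by move/(_ [::]).
elim: pm => //.
- by move=> F s t _ IH Λ; rewrite -!cat_rcons; apply: IH.
- move=> F G s Λ p; case: (p) => d h; by_rule (ExchR d).
  by apply: fits_size (provable_fits p); rewrite !size_cat.
- by move=> s t u _ IH1 _ IH2 Λ /IH1; apply: IH2.
Qed.

(** By the structural rules only the set of formulae in the antecedent matters:
    first the new antecedent is appended by weakening, then every old formula is
    contracted with its copy there. *)
Lemma provable_inclL Γ Γ' Δ :
  List.incl Γ Γ' -> provable Γ Δ -> provable Γ' Δ.
Proof.
move=> sub p.
have {p}: provable (Γ ++ Γ') Δ.
  elim: Γ' {sub} => [|F Γ' IH]; first by rewrite cats0.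
  apply: provable_permL (provable_WeakL F IH).
  apply: Permutation_trans (perm_catC _ [:: F]) _.
  exact: (Permutation_middle Γ Γ' F).
elim: Γ sub => [//|F Γ IH] sub p.
apply: IH => [G inG|]; first by apply: sub; right.
have [|Λ pm] := @In_perm _ F (Γ ++ Γ').
  by apply/In_cat; right; apply: sub; left.
apply: provable_permL (Permutation_sym pm) _.
apply: provable_ContrL; apply: provable_permL p => /=.
apply: Permutation_trans (perm_skip F pm) _.
by rewrite -[[:: F; F]]/([:: F] ++ [:: F]) catA; apply: (perm_catC [:: F]).
Qed.

Lemma provable_inclR Γ Δ Δ' :
  fits Δ' -> List.incl Δ Δ' -> provable Γ Δ -> provable Γ Δ'.
Proof.
move=> fit sub p; have fit0 := provable_fits p.
have [E|triv] : c = LJeq12 \/ forall Λ, fits Λ by rewrite /fits; case: c; auto.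
  (* In LJ contraction on the right would leave the calculus, but with at most
     one formula on each side the inclusion is an equality or a weakening. *)
  rewrite /fits E in fit fit0.
  case: Δ p sub fit0 => [|A [|?]] p sub //= _.
    case: Δ' fit {sub} => [|B [|?]] //= _.
    by apply: (@provable_WeakR Γ [::] B) p; rewrite /fits E.
  have inA: List.In A Δ' by apply: sub; left.
  by case: Δ' fit inA {sub} => [|B [|?]] //= _ [] // ->.
have {p}: provable Γ (Δ ++ Δ').
  elim: Δ' {sub fit} => [|F Δ' IH]; first by rewrite cats0.
  apply: provable_permR (provable_WeakR (triv (_ ++ [:: F])) IH).
  apply: Permutation_trans (perm_catC _ [:: F]) _.
  exact: (Permutation_middle Δ Δ' F).
elim: Δ sub {fit0} => [//|F Δ IH] sub p.
apply: IH => [G inG|]; first by apply: sub; right.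
have [|Λ pm] := @In_perm _ F (Δ ++ Δ').
  by apply/In_cat; right; apply: sub; left.
apply: provable_permR (Permutation_sym pm) _.
apply: provable_ContrR; apply: provable_permR p => /=.
apply: Permutation_trans (perm_skip F pm) _.
by rewrite -[[:: F; F]]/([:: F] ++ [:: F]) catA; apply: (perm_catC [:: F]).
Qed.

Lemma provable_incl Γ Γ' Δ Δ' : fits Δ' ->
  List.incl Γ Γ' -> List.incl Δ Δ' -> provable Γ Δ -> provable Γ' Δ'.
Proof.
by move=> fit subL subR p; apply: provable_inclL subL _; apply: provable_inclR p.
Qed.

Lemma provable_NotL Γ Δ A :
  provable Γ (Δ ++ [:: A]) -> provable (Γ ++ [:: Not A]) Δ.
Proof. by move=> p; case: (p) => d h; by_rule (NotL d). Qed.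

Lemma provable_NotR Γ Δ A : fits (Δ ++ [:: Not A]) ->
  provable (Γ ++ [:: A]) Δ -> provable Γ (Δ ++ [:: Not A]).
Proof. by move=> f p; case: (p) => d h; by_rule (NotR d). Qed.

Lemma provable_AndL1 Γ Δ A B :
  provable (Γ ++ [:: A]) Δ -> provable (Γ ++ [:: And A B]) Δ.
Proof. by move=> p; case: (p) => d h; by_rule (AndL1 B d). Qed.

Lemma provable_AndL2 Γ Δ A B :
  provable (Γ ++ [:: B]) Δ -> provable (Γ ++ [:: And A B]) Δ.
Proof. by move=> p; case: (p) => d h; by_rule (AndL2 A d). Qed.

Lemma provable_AndR Γ Δ A B : provable Γ (Δ ++ [:: A]) ->
  provable Γ (Δ ++ [:: B]) -> provable Γ (Δ ++ [:: And A B]).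
Proof.
by move=> p q; case: (p) (q) => d h [e k]; by_rule (AndR d e).
Qed.

Lemma provable_OrL Γ Δ A B : provable (Γ ++ [:: A]) Δ ->
  provable (Γ ++ [:: B]) Δ -> provable (Γ ++ [:: Or A B]) Δ.
Proof.
by move=> p q; case: (p) (q) => d h [e k]; by_rule (OrL d e).
Qed.

Lemma provable_OrR1 Γ Δ A B :
  provable Γ (Δ ++ [:: A]) -> provable Γ (Δ ++ [:: Or A B]).
Proof. by move=> p; case: (p) => d h; by_rule (OrR1 B d). Qed.

Lemma provable_OrR2 Γ Δ A B :
  provable Γ (Δ ++ [:: B]) -> provable Γ (Δ ++ [:: Or A B]).
Proof. by move=> p; case: (p) => d h; by_rule (OrR2 A d). Qed.

Lemma provable_ImpL Γ Λ Δ Θ A B :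
  provable Γ (Δ ++ [:: A]) -> provable (Λ ++ [:: B]) Θ ->
  provable (Γ ++ Λ ++ [:: Imp A B]) (Δ ++ Θ).
Proof.
move=> p q; case: (p) (q) => d h [e k]; by_rule (ImpL d e).
exact: fits_rcons_cat (provable_fits p) (provable_fits q).
Qed.

Lemma provable_ImpR Γ Δ A B :
  provable (Γ ++ [:: A]) (Δ ++ [:: B]) -> provable Γ (Δ ++ [:: Imp A B]).
Proof. by move=> p; case: (p) => d h; by_rule (ImpR d). Qed.

Lemma provable_AllL Γ Δ (A : formula L 1) t :
  provable (Γ ++ [:: inst A t]) Δ -> provable (Γ ++ [:: All A]) Δ.
Proof. by move=> p; case: (p) => d h; by_rule (AllL d). Qed.

Lemma provable_AllR Γ Δ (A : formula L 1) a :
  eigenvariable a (Γ ⇒ Δ ++ [:: All A]) ->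
  provable Γ (Δ ++ [:: inst A (Free a)]) -> provable Γ (Δ ++ [:: All A]).
Proof. by move=> ev p; case: (p) => d h; by_rule (AllR ev d). Qed.

Lemma provable_ExL Γ Δ (A : formula L 1) a :
  eigenvariable a (Γ ++ [:: Ex A] ⇒ Δ) ->
  provable (Γ ++ [:: inst A (Free a)]) Δ -> provable (Γ ++ [:: Ex A]) Δ.
Proof. by move=> ev p; case: (p) => d h; by_rule (ExL ev d). Qed.

Lemma provable_ExR Γ Δ (A : formula L 1) t :
  provable Γ (Δ ++ [:: inst A t]) -> provable Γ (Δ ++ [:: Ex A]).
Proof. by move=> p; case: (p) => d h; by_rule (ExR d). Qed.

Context (prec_asym : forall r s : term L 0, prec r s -> ~ prec s r).

(** [rewrites Γ s r]: an equation in [Γ] allows a semishortening equality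
    inference with [s] in the conclusion and [r] in the premiss.  The first
    disjunct is the orientation of [Eq2] and [Eq2L], the second that of [Eq1]
    and [Eq1L]. *)
Definition rewrites Γ (s r : term L 0) :=
  (List.In (Eq s r) Γ /\ ~ prec s r) \/ (List.In (Eq r s) Γ /\ prec r s).

Lemma provable_rewriteR Γ Δ F v r s :
  ~ toccurs v r -> ~ toccurs v s -> rewrites Γ s r ->
  provable Γ (Δ ++ [:: F{{v/r}}]) -> provable Γ (Δ ++ [:: F{{v/s}}]).
Proof.
move=> vr vs rew p; have fit := fits_rcons F{{v/s}} (provable_fits p).
case: rew (p) => [[inE prs] | [inE prs]] [d h].
  apply: (@provable_inclL (Γ ++ [:: Eq s r])).
    by move=> G; rewrite In_cat /= => -[|[<-|]].
  by by_rule (Eq2 vr vs d).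
apply: (@provable_inclL (Γ ++ [:: Eq r s])).
  by move=> G; rewrite In_cat /= => -[|[<-|]].
by by_rule (Eq1 vr vs d); apply: prec_asym.
Qed.

Lemma provable_rewriteL Γ Δ F v r s :
  ~ toccurs v r -> ~ toccurs v s -> rewrites Γ s r -> List.In F{{v/s}} Γ ->
  provable (Γ ++ [:: F{{v/r}}]) Δ -> provable Γ Δ.
Proof.
move=> vr vs rew inF p; have fit := provable_fits p.
case: rew (p) => [[inE prs] | [inE prs]] [d h].
  apply: (@provable_inclL (Γ ++ [:: F{{v/s}}; Eq s r])).
    by move=> G; rewrite In_cat /= => -[|[<-|[<-|]]].
  by by_rule (Eq2L vr vs d).
apply: (@provable_inclL (Γ ++ [:: F{{v/s}}; Eq r s])).
  by move=> G; rewrite In_cat /= => -[|[<-|[<-|]]].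
by by_rule (Eq1L vr vs d); apply: prec_asym.
Qed.

End Rules.

(** * Fresh variables *)

Section Fresh.
Context (L : language).

Fixpoint tsup n (t : term L n) : nat :=
  match t with
  | Free v => v.+1
  | Bound _ => 0
  | App f ts => \max_(i < fun_arity f) tsup (ts i)
  end.

Fixpoint fsup n (A : formula L n) : nat :=
  match A with
  | Rel p ts => \max_(i < rel_arity p) tsup (ts i)
  | Eq t u => maxn (tsup t) (tsup u)
  | Not B => fsup B
  | And B C | Or B C | Imp B C => maxn (fsup B) (fsup C)
  | All B | Ex B => fsup B
  end.

Lemma toccurs_tsup v n (t : term L n) : toccurs v t -> v < tsup t.
Proof.
elim: t => //= [w -> // | f ts IH [i /IH lt]].
exact: leq_trans lt (leq_bigmax i).
Qed.

Lemma tsup_fresh v n (t : term L n) : tsup t <= v -> ~ toccurs v t.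
Proof. by move=> le /toccurs_tsup; rewrite ltnNge le. Qed.

Lemma foccurs_fsup v n (A : formula L n) : foccurs v A -> v < fsup A.
Proof.
elim: A => {n} [n p ts [i /toccurs_tsup lt]|n t u||||||] //=;
  try by move=> n A IHA B IHB; rewrite leq_max => -[/IHA|/IHB] ->; rewrite ?orbT.
- exact: leq_trans lt (leq_bigmax i).
- by rewrite leq_max => -[/toccurs_tsup|/toccurs_tsup] ->; rewrite ?orbT.
Qed.

Lemma fresh_for (Γ : seq (formula L 0)) :
  exists N, forall v, N <= v -> ~ soccurs v Γ.
Proof.
exists (\max_(A <- Γ) fsup A).
elim: Γ => [|A Γ IH] v /=; first by move=> _ [].
rewrite big_cons geq_max => /andP [leA le].
by case=> [/foccurs_fsup|]; [rewrite ltnNge leA | apply: IH].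
Qed.

Lemma soccurs_cat v (Γ Δ : seq (formula L 0)) :
  soccurs v (Γ ++ Δ) <-> soccurs v Γ \/ soccurs v Δ.
Proof. by elim: Γ => /= [|A Γ ->]; tauto. Qed.

Lemma tbind_id n (sigma : 'I_n -> term L n) :
  (forall i, sigma i = Bound i) -> forall t, tbind sigma t = t.
Proof.
move=> id_s; elim=> //= f ts IH; congr App.
by apply: functional_extensionality => i; apply: IH.
Qed.

Lemma weaken0 (t : term L 0) : weaken 0 t = t.
Proof. by apply: tbind_id => -[]. Qed.

Lemma tsubst_fresh v x n (t : term L n) : ~ toccurs v t -> tsubst v x t = t.
Proof.
elim: t => //= [w | f ts IH] h; first by case: eqP.
congr App; apply: functional_extensionality => i.
by apply: IH => occ; apply: h; exists i.
Qed.

End Fresh.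

(** * Contexts with one hole *)

Section Update.
Context (n : nat) (T : Type).
Implicit Types (ts us : 'I_n -> T) (i j k : 'I_n).

Definition upd ts i x : 'I_n -> T := fun j => if j == i then x else ts j.

Lemma upd_same ts i x : upd ts i x i = x.
Proof. by rewrite /upd eqxx. Qed.

Lemma upd_self ts i : upd ts i (ts i) = ts.
Proof. by apply: functional_extensionality => j; rewrite /upd; case: eqP => [->|]. Qed.

Lemma upd_comm ts i j x y : i <> j ->
  upd (upd ts i x) j y = upd (upd ts j y) i x.
Proof.
move=> ne; apply: functional_extensionality => k; rewrite /upd.
by case: (k =P j) => // ->; case: eqP => // eji; case: ne.
Qed.

(** Two updates with the same result either write the same entry at the same
    place, or each vector already contains the entry that the other update
    writes, so that both updates start from one vector [vs]. *)
Lemma upd_eq ts us i j x y : upd ts i x = upd us j y ->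
  [/\ i = j, x = y & upd ts i = upd us j]
  \/ exists2 vs, i <> j & (upd ts i = upd (upd vs j y) i) /\
                          (upd us j = upd (upd vs i x) j).
Proof.
move=> E; have Ek k : upd ts i x k = upd us j y k by rewrite E.
case: (i =P j) => [eij|ne]; [left | right].
  subst j; split=> //; first by have := Ek i; rewrite !upd_same.
  apply: functional_extensionality => z.
  apply: functional_extensionality => k.
  by have := Ek k; rewrite /upd; case: eqP.
have tsj : ts j = y by have := Ek j; rewrite upd_same /upd; case: eqP => // /esym.
exists ts => //; split; first by rewrite -tsj upd_self.
apply: functional_extensionality => w.
apply: functional_extensionality => k.
by have := Ek k; rewrite /upd; case: (k =P j) => // _ <-.
Qed.

End Update.

Section Contexts.
Context (L : language).
Local Notation tm := (term L 0).
Local Notation fm := (formula L 0).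

(** Contexts are functions rather than terms with a marked hole, so that
    composing and filling them is mere application. *)
Inductive tctx : (tm -> tm) -> Prop :=
| tctx_hole : tctx (fun x => x)
| tctx_app f ts i C : tctx C -> tctx (fun x => @App L 0 f (upd ts i (C x))).

Inductive actx : (tm -> fm) -> Prop :=
| actx_rel p ts i C : tctx C -> actx (fun x => @Rel L 0 p (upd ts i (C x)))
| actx_eql t C : tctx C -> actx (fun x => Eq (C x) t)
| actx_eqr t C : tctx C -> actx (fun x => Eq t (C x)).

Lemma tctx_comp C D : tctx C -> tctx D -> tctx (fun x => C (D x)).
Proof.
by move=> cC cD; elim: cC => // f ts i {}C _; apply: tctx_app.
Qed.

Lemma actx_comp C D : actx C -> tctx D -> actx (fun x => C (D x)).
Proof. by case=> > cC cD; constructor; apply: (tctx_comp cC). Qed.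

Lemma tctx_subst C : tctx C ->
  exists N, forall v, N <= v -> forall x, tsubst v x (C (Free v)) = C x.
Proof.
elim=> [|f ts i {}C _ [N IH]].
  by exists 0 => v _ x; rewrite /= eqxx weaken0.
exists (maxn N (\max_j tsup (ts j))) => v; rewrite geq_max => /andP [leN le] x /=.
congr App; apply: functional_extensionality => j; rewrite /upd.
case: eqP => _; first exact: IH.
by apply/tsubst_fresh/tsup_fresh; apply: leq_trans le; apply: leq_bigmax.
Qed.

(** A free variable that is fresh for the context turns it into a formula to
    which the equality rules apply. *)
Lemma actx_subst C : actx C ->
  exists N, forall v, N <= v -> forall x, fsubst v x (C (Free v)) = C x.
Proof.
case=> [p ts i D|t D|t D] /tctx_subst [N HN].
- exists (maxn N (\max_j tsup (ts j))) => v; rewrite geq_max => /andP [leN le] x /=.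
  congr Rel; apply: functional_extensionality => j; rewrite /upd.
  case: eqP => _; first exact: HN.
  by apply/tsubst_fresh/tsup_fresh; apply: leq_trans le; apply: leq_bigmax.
- exists (maxn N (tsup t)) => v; rewrite geq_max => /andP [leN le] x /=.
  by rewrite HN // tsubst_fresh //; apply: tsup_fresh.
- exists (maxn N (tsup t)) => v; rewrite geq_max => /andP [leN le] x /=.
  by rewrite HN // tsubst_fresh //; apply: tsup_fresh.
Qed.

Section Overlap.
Context (a b c d : tm).

(** The relative position of the hole of [C], filled with [c], and the hole of
    [D], filled with [a], in the same expression: disjoint, the former inside
    [a], or the latter inside [c].  In the disjoint case [C'] and [D'] are the
    contexts that remain when the other hole is filled with [b] and [d]. *)
Definition overlap T (P : (tm -> T) -> Prop) (C D : tm -> T) :=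
  [\/ exists C' D', [/\ P C', P D' & [/\ D b = C' c, C d = D' a & C' d = D' b]],
      exists2 M, tctx M & a = M c /\ forall x, C x = D (M x)
    | exists2 M, tctx M & c = M a /\ forall x, D x = C (M x)].

Lemma overlap_comp T (P : (tm -> T) -> Prop) (K : tm -> T) C D :
  (forall M, tctx M -> P (fun x => K (M x))) ->
  overlap tctx C D -> overlap P (fun x => K (C x)) (fun x => K (D x)).
Proof.
move=> PK [[C' [D' [cC cD [e1 e2 e3]]]]|[M cM [e1 e2]]|[M cM [e1 e2]]].
- constructor 1; exists (fun x => K (C' x)), (fun x => K (D' x)).
  by split; rewrite ?e1 ?e2 ?e3; auto.
- by constructor 2; exists M => //; split=> // x; rewrite e2.
- by constructor 3; exists M => //; split=> // x; rewrite e2.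
Qed.

Lemma overlap_upd n T (P : (tm -> T) -> Prop) (K : ('I_n -> tm) -> T)
    ts us i j C D :
  (forall vs k M, tctx M -> P (fun x => K (upd vs k (M x)))) ->
  tctx C -> tctx D -> (C c = D a -> overlap tctx C D) ->
  upd ts i (C c) = upd us j (D a) ->
  overlap P (fun x => K (upd ts i (C x))) (fun x => K (upd us j (D x))).
Proof.
move=> PK cC cD IH E; have [[_ {}/IH IH upd_ij]|[vs ne [-> ->]]] := upd_eq E.
  rewrite -upd_ij; apply: (@overlap_comp _ P (fun x => K (upd ts i x))) IH => M; apply: PK.
constructor 1; exists (fun x => K (upd (upd vs j (D b)) i (C x))).
exists (fun x => K (upd (upd vs i (C d)) j (D x))).
by split; auto; split; congr K; first [exact: upd_comm | exact/esym/upd_comm].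
Qed.

Lemma tctx_overlap C D : tctx C -> tctx D -> C c = D a -> overlap tctx C D.
Proof.
move=> cC; elim: cC D => [|f ts i {}C cC IH] D cD.
  by move=> E; constructor 3; exists D.
case: cD => [E|g us j {}D cD E].
  by constructor 2; exists (fun x => App f (upd ts i (C x))) => //; constructor.
have Efg : f = g by case: E.
move: us j E; rewrite -{g}Efg => us j E.
apply: (@overlap_upd _ _ tctx (@App L 0 f)) => //; auto; first by constructor.
by case: E => E; exact: inj_pair2 E.
Qed.

Lemma actx_overlap C D : actx C -> actx D -> C c = D a -> overlap actx C D.
Proof.
move=> cC cD.
case: cC => [p ts i {}C cC|t {}C cC|t {}C cC];
  case: cD => [q us j {}D cD|u {}D cD|u {}D cD] // E.
- have Epq : p = q by case: E.
  move: us j E; rewrite -{q}Epq => us j E.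
  apply: (@overlap_upd _ _ actx (@Rel L 0 p)) => //; first by constructor.
    exact: tctx_overlap.
  by case: E => E; exact: inj_pair2 E.
- case: E => E <-; apply: (@overlap_comp _ actx (fun x => Eq x t)).
    by constructor.
  exact: tctx_overlap.
- case: E => Et Eu; constructor 1; exists (fun x => Eq (C x) (D b)).
  by exists (fun x => Eq (C d) (D x)); rewrite Et -Eu; split=> //; constructor.
- case: E => Et Eu; constructor 1; exists (fun x => Eq (D b) (C x)).
  by exists (fun x => Eq (D x) (C d)); rewrite Et -Eu; split=> //; constructor.
- case: E => <- E; apply: (@overlap_comp _ actx (fun x => Eq t x)).
    by constructor.
  exact: tctx_overlap.
Qed.

End Overlap.
End Contexts.

(** * The oriented atomic calculus *)

Section Atomic.
Context (L : language) (prec : term L 0 -> term L 0 -> Prop).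
Local Notation tm := (term L 0).
Local Notation fm := (formula L 0).
Local Notation rewrites := (rewrites prec).
Implicit Types (E : seq fm) (P : fm) (C : tm -> fm) (r s t : tm).

(** Inferences are read from conclusion to premiss and replace a single
    occurrence; replacing many at once would let the occurrences of one
    replacement overlap those of another in incompatible ways. *)
Inductive derives E P : Prop :=
| derives_ax : List.In P E -> derives E P
| derives_refl t : P = Eq t t -> derives E P
| derives_right C s r : actx C -> rewrites E s r -> P = C s ->
    derives E (C r) -> derives E P
| derives_left C s r : actx C -> rewrites E s r -> List.In (C s) E ->
    derives (C r :: E) P -> derives E P.

Lemma rewrites_incl E E' s r : List.incl E E' -> rewrites E s r -> rewrites E' s r.
Proof. by move=> sub [[/sub]|[/sub]]; [left | right]. Qed.

Lemma incl_cons E E' P : List.incl E E' -> List.incl (P :: E) (P :: E').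
Proof. by move=> sub Q /= [->|/sub]; [left | right]. Qed.

Lemma derives_incl E E' P : List.incl E E' -> derives E P -> derives E' P.
Proof.
move=> + d; elim: d E' => {E P}.
- by move=> E P inP E' sub; apply/derives_ax/sub.
- by move=> E P t -> E' sub; apply: derives_refl.
- move=> E P C s r aC rew -> _ IH E' sub.
  by apply: (derives_right aC (rewrites_incl sub rew)) => //; apply: IH.
- move=> E P C s r aC rew inC _ IH E' sub.
  apply: (derives_left aC (rewrites_incl sub rew) (sub _ inC)).
  exact/IH/incl_cons.
Qed.

Definition equation E s r := List.In (Eq s r) E \/ List.In (Eq r s) E.

Lemma equation_rewrites E s r : equation E s r -> rewrites E s r \/ rewrites E r s.
Proof.
rewrite /equation /rewrites.
by case: (classic (prec s r)); case: (classic (prec r s)); tauto.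
Qed.

Lemma rewrites_equation E s r : rewrites E s r -> equation E s r.
Proof. by rewrite /equation /rewrites; tauto. Qed.

(** A rewriting inside one side of an equation of [E], performed on the left,
    makes the rewritten equation available as well. *)
Lemma rewrite_equation E s r (C : tm -> tm) a b P :
  rewrites E s r -> tctx C -> a = C s -> equation E a b ->
  (forall E', List.incl E E' -> equation E' (C r) b -> derives E' P) ->
  derives E P.
Proof.
move=> rew cC -> eqn IH; case: eqn => inE.
  apply: (@derives_left _ _ (fun x => Eq (C x) b) s r) => //; first by constructor.
  by apply: IH; [move=> Q; right | left; left].
apply: (@derives_left _ _ (fun x => Eq b (C x)) s r) => //; first by constructor.
by apply: IH; [move=> Q; right | right; left].
Qed.

Lemma equation_sym E s r : equation E s r -> equation E r s.
Proof. by case; [right | left]. Qed.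

Lemma equation_incl E E' s r : List.incl E E' -> equation E s r -> equation E' s r.
Proof. by move=> sub [/sub|/sub]; [left | right]. Qed.

(** An equation may be used against its orientation.  If it permits rewriting
    [b] to [a], one inference suffices.  Otherwise [a] may be rewritten to [b],
    and one argues by induction on the derivation of [C a].  The antecedent [E']
    may be larger than [E] because overlaps add rewritten equations to it. *)
Lemma derives_replace E P : derives E P -> forall E' a b C,
  List.incl E E' -> equation E' a b -> actx C -> P = C a -> derives E' (C b).
Proof.
elim=> {E P} [E P inP|E P t EP|E P D s r aD rew EP d IH|E P D s r aD rew inD d IH]
  E' a b C sub eqn aC EC.
all: case: (equation_rewrites eqn) => [rewab|]; last first.
1,3,5,7: by move=> rewba; apply: (derives_right aC rewba) => //;
  rewrite -EC; apply: (derives_incl sub);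
  eauto using derives_ax, derives_refl, derives_right, derives_left.
(* An axiom [C a]: rewriting it on the left gives the axiom [C b]. *)
- apply: (derives_left aC rewab); first by rewrite -EC; apply: sub.
  by apply: derives_ax; left.
(* Reflexivity: rewriting the side left unchanged restores [t = t]. *)
- rewrite EP in EC; case: aC EC => // u M cM; [move=> [-> <-] | move=> [-> ->]].
    apply: (@derives_right _ _ (fun x => Eq (M b) (M x)) a b) => //.
      by constructor.
    exact: derives_refl.
  apply: (@derives_right _ _ (fun x => Eq (M x) (M b)) a b) => //.
    by constructor.
  exact: derives_refl.
- rewrite EP in EC.
  case: (@actx_overlap _ a b s r _ _ aD aC EC).
  (* disjoint places *)
  + case=> D' [C' [aD' aC' [e1 e2 e3]]]; rewrite e1.
    apply: (derives_right aD' (rewrites_incl sub rew)) => //; rewrite e3.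
    exact: IH e2.
  (* [s] inside [a]: the induction hypothesis is used with [M r = b] *)
  + case=> M cM [e1 e2].
    apply: (rewrite_equation (rewrites_incl sub rew) cM e1 eqn) => E2 sub2 eqn2.
    apply: IH eqn2 aC (e2 r) => Q /sub; exact: sub2.
  (* [a] inside [s]: the induction hypothesis is used with [r = M b] *)
  + case=> M cM [e1 e2]; rewrite e2.
    have eqn' := equation_incl sub (rewrites_equation rew).
    apply: (rewrite_equation rewab cM e1 eqn') => E2 sub2 eqn2.
    apply: IH (equation_sym eqn2) aD (erefl _) => Q /sub; exact: sub2.
- apply: (derives_left aD (rewrites_incl sub rew) (sub _ inD)).
  apply: IH aC EC; first exact: incl_cons.
  by apply: equation_incl eqn => Q; right.
Qed.

(** Cutting an equation: a derivation of [r = s] is a chain of rewritings, and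
    each of them can be carried out in [C] by [derives_replace]. *)
Lemma derives_Eq E r s : derives E (Eq r s) ->
  forall C, actx C -> derives E (C r) <-> derives E (C s).
Proof.
move Eq_P: (Eq r s) => P d.
elim: d r s Eq_P => {E P}
  [E P inP|E P t ->|E P D u v aD rew -> d IH|E P D u v aD rew inD d IH]
  r s EP C aC.
- by rewrite -EP in inP; split=> d; apply: (derives_replace d) aC (erefl _);
    try (by []); rewrite /equation; auto.
- by case: EP => -> ->.
- have eqn := rewrites_equation rew.
  have eqn' := equation_sym eqn.
  have refl : List.incl E E by [].
  case: aD EP d IH => // t M cM [-> ->] d /(_ _ _ erefl C aC) IH.
  + rewrite -IH; have aM := actx_comp aC cM.
    by split=> h; apply: (derives_replace h refl _ aM erefl).
  + rewrite IH; have aM := actx_comp aC cM.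
    by split=> h; apply: (derives_replace h refl _ aM erefl).
- split=> h; apply: (derives_left aD rew inD).
    by rewrite -(IH _ _ EP C aC); apply: derives_incl h => Q; right.
  by rewrite (IH _ _ EP C aC); apply: derives_incl h => Q; right.
Qed.

Context (c : calculus).
Context (prec_asym : forall r s : term L 0, prec r s -> ~ prec s r).

Lemma derives_provable E P : derives E P -> provable prec c E [:: P].
Proof.
have fit Q : fits c [:: Q] by rewrite /fits; case: c.
elim=> {E P} [E P inP|E P t ->|E P C s r aC rew -> d IH|E P C s r aC rew inC d IH].
- by apply: provable_inclL (provable_Ax _ _ P) => Q [<-|].
- by apply: provable_inclL (provable_Refl _ _ t) => Q.
all: have [N HN] := actx_subst aC; pose v := maxn N (maxn (tsup s) (tsup r)).
all: have leN : N <= v by rewrite leq_maxl.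
all: have vs : ~ toccurs v s by apply: tsup_fresh; rewrite /v !leq_max leqnn !orbT.
all: have vr : ~ toccurs v r by apply: tsup_fresh; rewrite /v !leq_max leqnn !orbT.
- rewrite -(HN v leN s); apply: (@provable_rewriteR _ _ _ prec_asym _ [::] _ v r s) => //.
  by rewrite HN.
- apply: (@provable_rewriteL _ _ _ prec_asym _ _ (C (Free v)) v r s) => //; rewrite HN //.
  apply: provable_inclL IH => Q /= [<-|inQ]; apply/In_cat; [right | left] => //.
  by left.
Qed.

End Atomic.

(** * Evaluation of terms *)

Section Evaluation.
Context (L : language).
Local Notation tm := (term L 0).
Implicit Types (σ : nat -> tm).

Fixpoint ev σ n (ρ : 'I_n -> tm) (t : term L n) : tm :=
  match t with
  | Free v => σ v
  | Bound i => ρ i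
  | App f ts => App f (fun i => ev σ ρ (ts i))
  end.

Definition ρ0 : 'I_0 -> tm := Bound.

Lemma env0 (ρ : 'I_0 -> tm) : ρ = ρ0.
Proof. by apply: functional_extensionality => -[]. Qed.

Definition scons n x (ρ : 'I_n -> tm) : 'I_n.+1 -> tm :=
  fun i => if unlift ord0 i is Some j then ρ j else x.

Definition assign σ v x : nat -> tm := fun w => if w == v then x else σ w.

Lemma ev_tbind σ m n (τ : 'I_m -> term L n) ρ t :
  ev σ ρ (tbind τ t) = ev σ (fun i => ev σ ρ (τ i)) t.
Proof.
elim: t => //= f ts IH; congr App.
by apply: functional_extensionality.
Qed.

Lemma ev_up σ m n (τ : 'I_m -> term L n) ρ x :
  (fun i => ev σ (scons x ρ) (up τ i)) = scons x (fun i => ev σ ρ (τ i)).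
Proof.
apply: functional_extensionality => i; rewrite /up /scons.
case: unlift => [j|] /=; last by rewrite unlift_none.
rewrite ev_tbind /=; congr ev.
by apply: functional_extensionality => k; rewrite liftK.
Qed.

Lemma ev_Free (t : tm) : ev Free ρ0 t = t.
Proof.
elim: t => //= f ts IH; congr App.
by apply: functional_extensionality.
Qed.

Lemma ev_tsubst σ v r n (ρ : 'I_n -> tm) t :
  ev σ ρ (tsubst v r t) = ev (assign σ v (ev σ ρ0 r)) ρ t.
Proof.
elim: t => //= [w|f ts IH].
  rewrite /assign; case: eqP => // _.
  by rewrite /weaken ev_tbind; congr ev; apply: env0.
by congr App; apply: functional_extensionality.
Qed.

Lemma ev_agree σ σ' n (ρ : 'I_n -> tm) t :
  (forall v, toccurs v t -> σ v = σ' v) -> ev σ ρ t = ev σ' ρ t.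
Proof.
elim: t => //= [v agree|f ts IH agree]; first exact: agree.
congr App; apply: functional_extensionality => i.
by apply: IH => v occ; apply: agree; exists i.
Qed.

End Evaluation.

Arguments ρ0 {L}.

(** * The model *)

Section Model.
Context (L : language) (prec : term L 0 -> term L 0 -> Prop) (c : calculus).
Context (prec_asym : forall r s : term L 0, prec r s -> ~ prec s r).
Local Notation tm := (term L 0).
Local Notation fm := (formula L 0).
Local Notation fits := (@fits L c).
Local Notation derives := (derives prec).

(** A sequent, written as a pair because it is the context of a formula rather
    than a conclusion. *)
Definition position : Type := seq fm * seq fm.
Implicit Types (w k : position) (X Y : position -> Prop).
Implicit Types (σ : nat -> tm) (Γ Δ : seq fm).

Definition join w k : position := (w.1 ++ k.1, w.2 ++ k.2).
Local Notation "w ⊗ k" := (join w k) (at level 40, left associativity).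

(** The pole of the orthogonality between worlds and tests. *)
Definition bot w := provable prec c w.1 w.2.

(** Members of denotations are worlds, and they are completed by tests.  In LJ a
    test owns the one formula of the succedent, so worlds have none.  In LK every
    position is both; this is what makes the model classical. *)
Definition world w := if c is LJeq12 then w.2 = [::] else True.
Definition test k : Prop := fits k.2.

Lemma world_join w w' : world w -> world w' -> world (w ⊗ w').
Proof. by rewrite /world /join; case: c => //= -> ->. Qed.

Lemma test_join w k : world w -> test k -> test (w ⊗ k).
Proof. by rewrite /world /test /fits /join; case: c => //= ->. Qed.

Lemma world_test w : world w -> test w.
Proof. by rewrite /world /test /fits; case: c => // ->. Qed.

Local Hint Resolve world_join test_join world_test : core.

Lemma bot_incl w w' : test w' ->
  List.incl w.1 w'.1 -> List.incl w.2 w'.2 -> bot w -> bot w'.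
Proof. exact: provable_incl. Qed.

Ltac bot_from h :=
  apply: (bot_incl _ _ _ h); [by auto | solve_incl | solve_incl].

Definition refutes k X := forall w, world w -> X w -> bot (w ⊗ k).

(** Biorthogonal closure: [cl X] has the worlds that no test can separate
    from [X]. *)
Definition cl X w := forall k, test k -> refutes k X -> bot (w ⊗ k).

Definition closed X := forall w, world w -> cl X w -> X w.

Definition atom P := cl (fun w => derives w.1 P).
Definition notS X w := forall w', world w' -> X w' -> bot (w ⊗ w').
Definition andS X Y w := X w /\ Y w.
Definition orS X Y := cl (fun w => X w \/ Y w).
Definition impS X Y w := forall w', world w' -> X w' -> Y (w ⊗ w').
Definition allS (X : tm -> position -> Prop) w := forall t, X t w.
Definition exS (X : tm -> position -> Prop) := cl (fun w => exists t, X t w).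

Fixpoint force σ n (ρ : 'I_n -> tm) (A : formula L n) : position -> Prop :=
  match A with
  | Rel p ts => atom (Rel p (fun i => ev σ ρ (ts i)))
  | Eq t u => atom (Eq (ev σ ρ t) (ev σ ρ u))
  | Not B => notS (force σ ρ B)
  | And B C => andS (force σ ρ B) (force σ ρ C)
  | Or B C => orS (force σ ρ B) (force σ ρ C)
  | Imp B C => impS (force σ ρ B) (force σ ρ C)
  | All B => allS (fun t => force σ (scons t ρ) B)
  | Ex B => exS (fun t => force σ (scons t ρ) B)
  end.

Lemma cl_unit X w : world w -> X w -> cl X w.
Proof. by move=> ww Xw k _; apply. Qed.

Lemma cl_mono X w w' : world w' ->
  List.incl w.1 w'.1 -> List.incl w.2 w'.2 -> cl X w -> cl X w'.
Proof.
move=> ww' sub1 sub2 Xw k tk ref; apply: (bot_incl _ _ _ (Xw k tk ref)); auto.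
  by move=> F /In_cat [/sub1|] ?; apply/In_cat; auto.
by move=> F /In_cat [/sub2|] ?; apply/In_cat; auto.
Qed.

(** The test [k] is enlarged by [w] itself, and the second copy of [w] is then
    contracted; the same device recurs throughout the soundness proof. *)
Lemma cl_bind X Y w : world w -> cl X w ->
  (forall w', world w' -> X w' -> cl Y (w ⊗ w')) -> cl Y w.
Proof.
move=> ww Xw XY k tk ref.
have: bot (w ⊗ (w ⊗ k)).
  apply: Xw => [|w' ww' Xw']; first by auto.
  by have := XY w' ww' Xw' k tk ref => h; bot_from h.
by move=> h; bot_from h.
Qed.

Lemma cl_closed X : closed (cl X).
Proof.
move=> w ww Xw k tk ref; apply: Xw => // w' ww' Xw'; exact: Xw'.
Qed.

(** Closures are closed, and the other connectives preserve closedness, hence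
    every denotation is determined by the tests that refute it. *)
Lemma force_closed σ n (ρ : 'I_n -> tm) A : closed (force σ ρ A).
Proof.
elim: A ρ => {n} [n p ts|n t u|n B IHB|n B IHB C IHC|n B IHB C IHC
  |n B IHB C IHC|n B IHB|n B IHB] ρ /=; try exact: cl_closed.
- move=> w ww Bw w' ww' Bw'; apply: Bw; first by auto.
  by move=> w2 ww2; apply.
- move=> w ww BCw; split; [apply: IHB => // | apply: IHC => //].
    by move=> k tk ref; apply: BCw => // w' ww' [Bw' _]; apply: ref.
  by move=> k tk ref; apply: BCw => // w' ww' [_ Cw']; apply: ref.
- move=> w ww BCw w' ww' Bw'; apply: IHC; first by auto.
  move=> k tk ref; have h: bot (w ⊗ (w' ⊗ k)).
    apply: BCw => [|w2 ww2 /(_ _ ww' Bw') Cw2]; first by auto.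
    by have h := ref _ (world_join ww2 ww') Cw2; bot_from h.
  by bot_from h.
- move=> w ww Bw t; apply: IHB => // k tk ref; apply: Bw => // w' ww' Bw'.
  exact: ref.
Qed.

Lemma force_mono σ n (ρ : 'I_n -> tm) A w w' : world w -> world w' ->
  List.incl w.1 w'.1 -> List.incl w.2 w'.2 -> force σ ρ A w -> force σ ρ A w'.
Proof.
move=> ww ww' sub1 sub2 Aw; apply: force_closed => //.
by apply: (cl_mono ww' sub1 sub2); apply: cl_unit.
Qed.

Ltac force_from h :=
  apply: (force_mono _ _ _ _ h); [by auto | by auto | solve_incl | solve_incl].

Lemma force_fbind σ m n (τ : 'I_m -> term L n) ρ A :
  force σ ρ (fbind τ A) = force σ (fun i => ev σ ρ (τ i)) A.
Proof.
elim: A n τ ρ => {m} [m p ts|m t u|m B IHB|m B IHB C IHC|m B IHB C IHC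
  |m B IHB C IHC|m B IHB|m B IHB] n τ ρ /=; rewrite ?IHB ?IHC ?ev_tbind //.
- congr (atom (Rel p _)); apply: functional_extensionality => i.
  by rewrite ev_tbind.
- by congr allS; apply: functional_extensionality => x; rewrite IHB ev_up.
- by congr exS; apply: functional_extensionality => x; rewrite IHB ev_up.
Qed.

Lemma force_inst σ (A : formula L 1) t :
  force σ ρ0 (inst A t) = force σ (scons (ev σ ρ0 t) ρ0) A.
Proof.
rewrite /inst force_fbind; congr force; apply: functional_extensionality => i.
by rewrite /scons; case: unlift => [[]|].
Qed.

Lemma force_fsubst σ v r n (ρ : 'I_n -> tm) A :
  force σ ρ (fsubst v r A) = force (assign σ v (ev σ ρ0 r)) ρ A.
Proof.
elim: A ρ => {n} [n p ts|n t u|n B IHB|n B IHB C IHC|n B IHB C IHC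
  |n B IHB C IHC|n B IHB|n B IHB] ρ /=; rewrite ?IHB ?IHC ?ev_tsubst //.
- congr (atom (Rel p _)); apply: functional_extensionality => i.
  by rewrite ev_tsubst.
- by congr allS; apply: functional_extensionality => x; rewrite IHB.
- by congr exS; apply: functional_extensionality => x; rewrite IHB.
Qed.

Lemma force_agree σ σ' n (ρ : 'I_n -> tm) A :
  (forall v, foccurs v A -> σ v = σ' v) -> force σ ρ A = force σ' ρ A.
Proof.
elim: A ρ => {n} [n p ts|n t u|n B IHB|n B IHB C IHC|n B IHB C IHC
  |n B IHB C IHC|n B IHB|n B IHB] ρ /= agree.
- congr (atom (Rel p _)); apply: functional_extensionality => i.
  by apply: ev_agree => v occ; apply: agree; exists i.
- by congr (atom (Eq _ _)); apply: ev_agree => v occ; apply: agree; auto.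
- by rewrite IHB.
- by rewrite IHB ?IHC // => v occ; apply: agree; auto.
- by rewrite IHB ?IHC // => v occ; apply: agree; auto.
- by rewrite IHB ?IHC // => v occ; apply: agree; auto.
- by congr allS; apply: functional_extensionality => x; apply: IHB.
- by congr exS; apply: functional_extensionality => x; apply: IHB.
Qed.

Lemma force_assign_fresh σ v x Γ A : ~ soccurs v Γ -> List.In A Γ ->
  force (assign σ v x) ρ0 A = force σ ρ0 A.
Proof.
move=> fresh inA; apply: force_agree => u occ; rewrite /assign.
case: eqP => // uv; case: fresh; rewrite -uv.
elim: Γ inA => //= B Γ IH [->|/IH]; auto.
Qed.

(** ** Equality in the model *)

Definition interchangeable E (r s : tm) :=
  forall C, actx C -> derives E (C r) <-> derives E (C s).

(** Contexts have one hole, so the entries are exchanged one after the other. *)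
Lemma interchangeable_vector E n (ts us : 'I_n -> tm) (K : ('I_n -> tm) -> fm) :
  (forall i, interchangeable E (ts i) (us i)) ->
  (forall vs i, actx (fun x => K (upd vs i x))) ->
  derives E (K ts) <-> derives E (K us).
Proof.
move=> tu aK; pose mix m (i : 'I_n) := if i < m then us i else ts i.
have <- : mix 0 = ts by apply: functional_extensionality.
have <- : mix n = us.
  by apply: functional_extensionality => i; rewrite /mix ltn_ord.
have: n <= n by []; move: {1 3}n => m.
elim: m => [//|m IH] ltm; rewrite IH ?(ltnW ltm) //.
pose i := Ordinal ltm.
have -> : mix m = upd (mix m) i (ts i).
  rewrite -[in LHS](upd_self (mix m) i); congr upd.
  by rewrite /mix ltnn.
have -> : mix m.+1 = upd (mix m) i (us i).
  apply: functional_extensionality => j; rewrite /upd /mix ltnS.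
  case: eqP => [->|ne]; first by rewrite leqnn.
  by rewrite leq_eqVlt; case: eqP => // e; case: ne; apply: val_inj.
exact: tu (aK _ _).
Qed.

Lemma interchangeable_ev E σ v r s n (ρ : 'I_n -> tm) t :
  derives E (Eq r s) ->
  interchangeable E (ev (assign σ v r) ρ t) (ev (assign σ v s) ρ t).
Proof.
move=> d; have eq_rs := derives_Eq d; elim: t => [w|i|f ts IH] C aC /=.
- by rewrite /assign; case: eqP => _; [apply: eq_rs | split].
- by split.
- apply: (interchangeable_vector (K := fun vs => C (App f vs))).
    by move=> i; apply: IH.
  by move=> vs i; apply: (actx_comp aC); do 2!constructor.
Qed.

Lemma atom_bind P Q R w : world w ->
  (forall E, derives E P -> derives E Q -> derives E R) ->
  atom P w -> atom Q w -> atom R w.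
Proof.
move=> ww PQR Pw Qw; apply: (cl_bind ww Pw) => w1 ww1 Pw1.
have {}Qw : atom Q (w ⊗ w1) by apply: cl_mono Qw; [auto | solve_incl | solve_incl].
apply: (cl_bind _ Qw) => [|w2 ww2 Qw2]; first by auto.
apply: cl_unit; first by auto.
by apply: PQR; [apply: derives_incl Pw1 | apply: derives_incl Qw2]; solve_incl.
Qed.

Lemma atom_Eq_refl t w : world w -> atom (Eq t t) w.
Proof. by move=> ww; apply: cl_unit => //; apply: derives_refl. Qed.

Lemma atom_Eq_sym r s w : world w -> atom (Eq r s) w -> atom (Eq s r) w.
Proof.
move=> ww eq_rs; apply: (atom_bind ww _ eq_rs eq_rs) => E d _.
have aC : actx (fun x => Eq x r) by constructor; constructor.
by rewrite -(derives_Eq d aC); apply: derives_refl.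
Qed.

(** Implication and negation use the equation from right to left, so both
    directions are proved together by quantifying over [r] and [s]. *)
Lemma force_Eq σ v r s n (ρ : 'I_n -> tm) A w : world w -> atom (Eq r s) w ->
  force (assign σ v r) ρ A w -> force (assign σ v s) ρ A w.
Proof.
elim: A r s ρ w => {n} [n p ts|n t u|n B IHB|n B IHB C IHC|n B IHB C IHC
  |n B IHB C IHC|n B IHB|n B IHB] r s ρ w ww eq_rs /=.
- apply: (atom_bind ww _ eq_rs) => E d.
  apply: (proj1 (interchangeable_vector (K := @Rel L 0 p) _ _)).
    by move=> i; apply: interchangeable_ev d.
  by move=> vs i; do 2!constructor.
- apply: (atom_bind ww _ eq_rs) => E d.
  have aL : actx (fun x => Eq x (ev (assign σ v r) ρ u)) by do 2!constructor.
  have aR : actx (fun x => Eq (ev (assign σ v s) ρ t) x) by do 2!constructor.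
  move=> h; apply/(interchangeable_ev σ v ρ u d aR).
  exact/(interchangeable_ev σ v ρ t d aL).
- move=> Bw w' ww' Bw'.
  have ww2 : world (w ⊗ w') by auto.
  have eq_sr : atom (Eq s r) (w ⊗ w').
    by apply: atom_Eq_sym => //; apply: cl_mono eq_rs; [auto | solve_incl | solve_incl].
  have {}Bw' : force (assign σ v s) ρ B (w ⊗ w') by force_from Bw'.
  by have h := Bw _ ww2 (IHB _ _ _ _ ww2 eq_sr Bw'); bot_from h.
- by case=> Bw Cw; split; [apply: IHB eq_rs Bw | apply: IHC eq_rs Cw].
- move=> BCw; apply: (cl_bind ww BCw) => w' ww' BCw'.
  have ww2 : world (w ⊗ w') by auto.
  have eq2 : atom (Eq r s) (w ⊗ w').
    by apply: cl_mono eq_rs; [auto | solve_incl | solve_incl].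
  apply: cl_unit => //; case: BCw' => h; [left | right].
    by apply: IHB eq2 _ => //; force_from h.
  by apply: IHC eq2 _ => //; force_from h.
- move=> BCw w' ww' Bw'.
  have ww2 : world (w ⊗ w') by auto.
  have eq2 : atom (Eq r s) (w ⊗ w').
    by apply: cl_mono eq_rs; [auto | solve_incl | solve_incl].
  have {}Bw' : force (assign σ v s) ρ B (w ⊗ w') by force_from Bw'.
  have h := BCw _ ww2 (IHB _ _ _ _ ww2 (atom_Eq_sym ww2 eq2) Bw').
  by apply: IHC eq2 _ => //; force_from h.
- by move=> Bw t; apply: IHB eq_rs (Bw t).
- move=> Bw; apply: (cl_bind ww Bw) => w' ww' [t Bw'].
  have ww2 : world (w ⊗ w') by auto.
  have eq2 : atom (Eq r s) (w ⊗ w').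
    by apply: cl_mono eq_rs; [auto | solve_incl | solve_incl].
  apply: cl_unit => //; exists t.
  by apply: IHB eq2 _ => //; force_from Bw'.
Qed.

(** ** Soundness *)

Definition forces σ Γ w := forall A, List.In A Γ -> force σ ρ0 A w.
Definition refutes_all σ Δ k := forall B, List.In B Δ -> refutes k (force σ ρ0 B).

(** Succedent formulae are interpreted through the tests that refute them, which
    gives one notion of validity for LJ and LK. *)
Definition valid Γ Δ := forall σ w k, world w -> test k ->
  forces σ Γ w -> refutes_all σ Δ k -> bot (w ⊗ k).

Lemma forces_cat σ Γ Λ w : forces σ (Γ ++ Λ) w <-> forces σ Γ w /\ forces σ Λ w.
Proof.
split=> [h|[h1 h2] A /In_cat [/h1|/h2]] //.
by split=> A inA; apply: h; apply/In_cat; auto.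
Qed.

Lemma forces_cons σ A Γ w : forces σ (A :: Γ) w <-> force σ ρ0 A w /\ forces σ Γ w.
Proof.
split=> [h|[h1 h2] B /= [<-|/h2]] //.
by split=> [|B inB]; apply: h; [left | right].
Qed.

Lemma forces1 σ A w : forces σ [:: A] w <-> force σ ρ0 A w.
Proof. by split=> [h|h B /= [<-|]] //; apply: h; left. Qed.

Lemma refutes_all_cat σ Δ Θ k :
  refutes_all σ (Δ ++ Θ) k <-> refutes_all σ Δ k /\ refutes_all σ Θ k.
Proof.
split=> [h|[h1 h2] A /In_cat [/h1|/h2]] //.
by split=> A inA; apply: h; apply/In_cat; auto.
Qed.

Lemma refutes_all1 σ B k : refutes_all σ [:: B] k <-> refutes k (force σ ρ0 B).
Proof. by split=> [h|h C /= [<-|]] //; apply: h; left. Qed.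

Lemma forces_join σ Γ w w' : world w -> world w' ->
  forces σ Γ w -> forces σ Γ (w ⊗ w').
Proof. by move=> ww ww' h A /h Aw; force_from Aw. Qed.

Lemma refutes_join w k X : world w -> test k -> refutes k X -> refutes (w ⊗ k) X.
Proof. by move=> ww tk ref w' ww' /(ref _ ww') h; bot_from h. Qed.

Lemma refutes_all_join σ Δ w k : world w -> test k ->
  refutes_all σ Δ k -> refutes_all σ Δ (w ⊗ k).
Proof. by move=> ww tk ref B /ref; apply: refutes_join. Qed.

Lemma bot_contract w k : world w -> test k -> bot (w ⊗ (w ⊗ k)) -> bot (w ⊗ k).
Proof. by move=> ww tk h; bot_from h. Qed.

Lemma valid_incl Γ Γ' Δ Δ' : List.incl Γ Γ' -> List.incl Δ Δ' ->
  valid Γ Δ -> valid Γ' Δ'.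
Proof.
move=> subL subR v σ w k ww tk fw rk; apply: v ww tk _ _.
  by move=> A /subL; apply: fw.
by move=> B /subR; apply: rk.
Qed.

(** A test that refutes the conclusion, enlarged by a world that forces its
    antecedent, refutes [F] by the second premiss. *)
Lemma valid_Cut Γ Λ Δ Θ F : valid Γ (Δ ++ [:: F]) -> valid (Λ ++ [:: F]) Θ ->
  valid (Γ ++ Λ) (Δ ++ Θ).
Proof.
move=> v1 v2 σ w k ww tk /forces_cat [fΓ fΛ] /refutes_all_cat [rΔ rΘ].
apply: bot_contract => //; apply: (v1 σ); rewrite ?refutes_all_cat ?refutes_all1; auto.
split; first exact: refutes_all_join.
move=> w' ww' Fw'; have h : bot ((w ⊗ w') ⊗ k).
  apply: (v2 σ); auto; apply/forces_cat; split; first exact: forces_join.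
  by apply/forces1; force_from Fw'.
by bot_from h.
Qed.

(** For the right rules of negation, implication and the universal quantifier
    the principal formula must be forced at some world.  In LJ this is [w], as
    [Δ] is empty; in LK the test [k] may be taken as part of the world. *)
Lemma valid_right Γ Δ B : fits (Δ ++ [:: B]) ->
  (forall σ w, world w -> forces σ Γ w -> refutes_all σ Δ w ->
    force σ ρ0 B w) ->
  valid Γ (Δ ++ [:: B]).
Proof.
move=> fit h σ w k ww tk fw /refutes_all_cat [rΔ /refutes_all1 rB].
have [E|E] : c = LJeq12 \/ c = LKeq12 by case: c; auto.
  apply: (rB) => //; apply: h => //.
  by move: fit; rewrite /fits E; case: Δ {rΔ} => [|? []] //= _ C [].
have wk : world k by rewrite /world E.
have h2 : bot ((w ⊗ k) ⊗ k).
  apply: rB; auto; apply: h; auto; first exact: forces_join.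
  exact: refutes_all_join.
by bot_from h2.
Qed.

Lemma valid_NotL Γ Δ A : valid Γ (Δ ++ [:: A]) -> valid (Γ ++ [:: Not A]) Δ.
Proof.
move=> v σ w k ww tk /forces_cat [fΓ /forces1 /= nA] rΔ.
apply: bot_contract => //; apply: (v σ); rewrite ?refutes_all_cat ?refutes_all1; auto.
split; first exact: refutes_all_join.
by move=> w' ww' /(nA _ ww') h; bot_from h.
Qed.

Lemma valid_NotR Γ Δ A : fits (Δ ++ [:: Not A]) ->
  valid (Γ ++ [:: A]) Δ -> valid Γ (Δ ++ [:: Not A]).
Proof.
move=> fit v; apply: valid_right => // σ w ww fΓ rΔ w' ww' Aw'.
have h : bot ((w ⊗ w') ⊗ w).
  apply: (v σ); auto; apply/forces_cat; split; first exact: forces_join.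
  by apply/forces1; force_from Aw'.
by bot_from h.
Qed.

(** Added to [k], a world forcing [A] gives a test that refutes [B], so the
    second premiss applies; this makes [k] extended by [w] a test that refutes
    [A], and the first premiss applies. *)
Lemma valid_AndR Γ Δ A B : valid Γ (Δ ++ [:: A]) -> valid Γ (Δ ++ [:: B]) ->
  valid Γ (Δ ++ [:: And A B]).
Proof.
move=> v1 v2 σ w k ww tk fΓ /refutes_all_cat [rΔ /refutes_all1 rAB].
apply: bot_contract => //; apply: (v1 σ); rewrite ?refutes_all_cat ?refutes_all1; auto.
split; first exact: refutes_all_join.
move=> w1 ww1 Aw1; have h : bot (w ⊗ (w1 ⊗ k)).
  apply: (v2 σ); rewrite ?refutes_all_cat ?refutes_all1; auto.
  split; first exact: refutes_all_join.
  move=> w2 ww2 Bw2; have h : bot ((w1 ⊗ w2) ⊗ k).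
    by apply: rAB; auto; split; [force_from Aw1 | force_from Bw2].
  by bot_from h.
by bot_from h.
Qed.

Lemma valid_OrL Γ Δ A B : valid (Γ ++ [:: A]) Δ -> valid (Γ ++ [:: B]) Δ ->
  valid (Γ ++ [:: Or A B]) Δ.
Proof.
move=> v1 v2 σ w k ww tk /forces_cat [fΓ /forces1 /= fAB] rΔ.
apply: bot_contract => //; apply: fAB; auto.
move=> w' ww' fAB; have h : bot ((w ⊗ w') ⊗ k).
  case: fAB => h; [apply: (v1 σ) | apply: (v2 σ)]; auto; apply/forces_cat;
    (split; first exact: forces_join); apply/forces1; force_from h.
by bot_from h.
Qed.

Lemma valid_OrR1 Γ Δ A B : valid Γ (Δ ++ [:: A]) -> valid Γ (Δ ++ [:: Or A B]).
Proof.
move=> v σ w k ww tk fΓ /refutes_all_cat [rΔ /refutes_all1 rAB].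
apply: (v σ) => //; apply/refutes_all_cat; split=> //; apply/refutes_all1.
by move=> w' ww' Aw'; apply: rAB => //; apply: cl_unit => //; left.
Qed.

Lemma valid_OrR2 Γ Δ A B : valid Γ (Δ ++ [:: B]) -> valid Γ (Δ ++ [:: Or A B]).
Proof.
move=> v σ w k ww tk fΓ /refutes_all_cat [rΔ /refutes_all1 rAB].
apply: (v σ) => //; apply/refutes_all_cat; split=> //; apply/refutes_all1.
by move=> w' ww' Bw'; apply: rAB => //; apply: cl_unit => //; right.
Qed.

Lemma valid_ImpL Γ Λ Δ Θ A B :
  valid Γ (Δ ++ [:: A]) -> valid (Λ ++ [:: B]) Θ ->
  valid (Γ ++ Λ ++ [:: Imp A B]) (Δ ++ Θ).
Proof.
move=> v1 v2 σ w k ww tk /forces_cat [fΓ /forces_cat [fΛ /forces1 /= fAB]].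
move=> /refutes_all_cat [rΔ rΘ].
apply: bot_contract => //; apply: (v1 σ); rewrite ?refutes_all_cat ?refutes_all1; auto.
split; first exact: refutes_all_join.
move=> w' ww' /(fAB _ ww') Bw; have h : bot ((w ⊗ w') ⊗ k).
  apply: (v2 σ); auto; apply/forces_cat; split; first exact: forces_join.
  exact/forces1.
by bot_from h.
Qed.

Lemma valid_ImpR Γ Δ A B : fits (Δ ++ [:: Imp A B]) ->
  valid (Γ ++ [:: A]) (Δ ++ [:: B]) -> valid Γ (Δ ++ [:: Imp A B]).
Proof.
move=> fit v; apply: valid_right => // σ w ww fΓ rΔ w' ww' Aw'.
apply: force_closed => [|k tk rB]; first by auto.
have h : bot ((w ⊗ w') ⊗ (w ⊗ k)).
  apply: (v σ); rewrite ?refutes_all_cat ?refutes_all1 ?forces_cat ?forces1; auto.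
    by split; [apply: forces_join | force_from Aw'].
  split; last exact: refutes_join.
  by move=> C /rΔ rC w2 ww2 /(rC _ ww2) h; bot_from h.
by bot_from h.
Qed.

Lemma valid_AllL Γ Δ (A : formula L 1) t :
  valid (Γ ++ [:: inst A t]) Δ -> valid (Γ ++ [:: All A]) Δ.
Proof.
move=> v σ w k ww tk /forces_cat [fΓ /forces1 /= fA] rΔ.
apply: (v σ) => //; apply/forces_cat; split=> //; apply/forces1.
by rewrite force_inst.
Qed.

Lemma valid_ExR Γ Δ (A : formula L 1) t :
  valid Γ (Δ ++ [:: inst A t]) -> valid Γ (Δ ++ [:: Ex A]).
Proof.
move=> v σ w k ww tk fΓ /refutes_all_cat [rΔ /refutes_all1 rA].
apply: (v σ) => //; apply/refutes_all_cat; split=> //; apply/refutes_all1.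
rewrite force_inst => w' ww' Aw'; apply: rA => //; apply: cl_unit => //.
by exists (ev σ ρ0 t).
Qed.

Lemma soccurs_catN v Γ Λ : ~ soccurs v (Γ ++ Λ) -> ~ soccurs v Γ /\ ~ soccurs v Λ.
Proof. by rewrite soccurs_cat; tauto. Qed.

(** Reassigning the eigenvariable realises every instance of the quantifier
    semantically, so derivations never need to be substituted into. *)
Lemma force_assign_inst σ a x (A : formula L 1) : ~ foccurs a A ->
  force (assign σ a x) ρ0 (inst A (Free a)) = force σ (scons x ρ0) A.
Proof.
move=> fresh; rewrite force_inst /= {2}/assign eqxx.
apply: force_agree => v occ; rewrite /assign; case: eqP => // va.
by case: fresh; rewrite -va.
Qed.

Lemma forces_assign σ a x Γ w : ~ soccurs a Γ ->
  forces (assign σ a x) Γ w <-> forces σ Γ w.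
Proof.
by move=> fresh; split=> h A inA; have := h A inA;
  rewrite (force_assign_fresh _ _ fresh).
Qed.

Lemma refutes_all_assign σ a x Δ k : ~ soccurs a Δ ->
  refutes_all (assign σ a x) Δ k <-> refutes_all σ Δ k.
Proof.
by move=> fresh; split=> h A inA; have := h A inA;
  rewrite (force_assign_fresh _ _ fresh).
Qed.

Lemma valid_AllR Γ Δ (A : formula L 1) a : fits (Δ ++ [:: All A]) ->
  eigenvariable a (Γ ⇒ Δ ++ [:: All A]) ->
  valid Γ (Δ ++ [:: inst A (Free a)]) -> valid Γ (Δ ++ [:: All A]).
Proof.
move=> fit [/= aΓ /soccurs_catN [aΔ aA]] v.
have {}aA : ~ foccurs a A by move=> occ; apply: aA; left.
apply: valid_right => // σ w ww fΓ rΔ t.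
apply: force_closed => // k tk rA; apply: bot_contract => //.
apply: (v (assign σ a t)); rewrite ?refutes_all_cat ?refutes_all1 ?forces_assign; auto.
rewrite refutes_all_assign // force_assign_inst //.
split; last exact: refutes_join.
by move=> C /rΔ rC w2 ww2 /(rC _ ww2) h; bot_from h.
Qed.

Lemma valid_ExL Γ Δ (A : formula L 1) a :
  eigenvariable a (Γ ++ [:: Ex A] ⇒ Δ) ->
  valid (Γ ++ [:: inst A (Free a)]) Δ -> valid (Γ ++ [:: Ex A]) Δ.
Proof.
move=> [/= /soccurs_catN [aΓ aA] aΔ] v.
have {}aA : ~ foccurs a A by move=> occ; apply: aA; left.
move=> σ w k ww tk /forces_cat [fΓ /forces1 /= fA] rΔ.
apply: bot_contract => //; apply: fA; auto.
move=> w' ww' [t Aw']; have h : bot ((w ⊗ w') ⊗ k).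
  apply: (v (assign σ a t)); rewrite ?refutes_all_assign; auto.
  rewrite forces_cat forces1 forces_assign // force_assign_inst //.
  by split; [apply: forces_join | force_from Aw'].
by bot_from h.
Qed.

Lemma force_replace σ v r s (F : fm) w : world w ->
  force σ ρ0 (Eq r s) w \/ force σ ρ0 (Eq s r) w ->
  force σ ρ0 F{{v/r}} w -> force σ ρ0 F{{v/s}} w.
Proof.
move=> ww eq_rs; rewrite !force_fsubst; apply: force_Eq => //.
by case: eq_rs => // /atom_Eq_sym; apply.
Qed.

Lemma valid_EqR Γ Δ (F : fm) v r s E :
  E = Eq r s \/ E = Eq s r ->
  valid Γ (Δ ++ [:: F{{v/r}}]) -> valid (Γ ++ [:: E]) (Δ ++ [:: F{{v/s}}]).
Proof.
move=> eqE va σ w k ww tk /forces_cat [fΓ /forces1 fE].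
move=> /refutes_all_cat [rΔ /refutes_all1 rF].
apply: bot_contract => //; apply: (va σ); rewrite ?refutes_all_cat ?refutes_all1; auto.
split; first exact: refutes_all_join.
move=> w' ww' Fw'; have h : bot ((w ⊗ w') ⊗ k).
  apply: rF; auto; apply: (@force_replace _ _ r); first by auto.
    by case: eqE fE => -> h; [left | right]; force_from h.
  by force_from Fw'.
by bot_from h.
Qed.

Lemma valid_EqL Γ Δ (F : fm) v r s E :
  E = Eq r s \/ E = Eq s r ->
  valid (Γ ++ [:: F{{v/r}}]) Δ -> valid (Γ ++ [:: F{{v/s}}; E]) Δ.
Proof.
move=> eqE va σ w k ww tk /forces_cat [fΓ /forces_cons [fF /forces1 fE]] rΔ.
apply: (va σ) => //; apply/forces_cat; split=> //; apply/forces1.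
apply: force_replace fF => //.
by case: eqE fE => ->; [right | left].
Qed.

Theorem soundness S (d : derivation S) :
  derivation_in c d -> valid (antecedent S) (succedent S).
Proof.
move/derivation_in_fits; elim: d => {S} /=.
- move=> F _ σ w k ww tk /forces1 Fw /refutes_all1; exact.
- move=> t _ σ w k ww tk _ /refutes_all1 r; apply: r => //=.
  exact: atom_Eq_refl.
- by move=> Γ Δ F ? IH [_ /IH]; apply: valid_incl; solve_incl.
- by move=> Γ Δ F ? IH [_ /IH]; apply: valid_incl; solve_incl.
- by move=> Γ Λ Δ F G ? IH [_ /IH]; apply: valid_incl; solve_incl.
- by move=> Γ Δ Θ F G ? IH [_ /IH]; apply: valid_incl; solve_incl.
- by move=> Γ Δ F ? IH [_ /IH]; apply: valid_incl; solve_incl.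
- by move=> Γ Δ F ? IH [_ /IH]; apply: valid_incl; solve_incl.
- move=> Γ Λ Δ Θ F ? IH1 ? IH2 [_ [/IH1 v1 /IH2 v2]]; exact: valid_Cut v1 v2.
- by move=> Γ Δ A ? IH [_ /IH]; apply: valid_NotL.
- by move=> Γ Δ A ? IH [fit /IH]; apply: valid_NotR.
- move=> Γ Δ A B ? IH [_ /IH] v σ w k ww tk /forces_cat [fΓ /forces1 [fA _]].
  by apply: v => //; apply/forces_cat; rewrite forces1.
- move=> Γ Δ A B ? IH [_ /IH] v σ w k ww tk /forces_cat [fΓ /forces1 [_ fB]].
  by apply: v => //; apply/forces_cat; rewrite forces1.
- by move=> Γ Δ A B ? IH1 ? IH2 [_ [/IH1 v1 /IH2 v2]]; apply: valid_AndR.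
- by move=> Γ Δ A B ? IH1 ? IH2 [_ [/IH1 v1 /IH2 v2]]; apply: valid_OrL.
- by move=> Γ Δ A B ? IH [_ /IH]; apply: valid_OrR1.
- by move=> Γ Δ A B ? IH [_ /IH]; apply: valid_OrR2.
- by move=> Γ Λ Δ Θ A B ? IH1 ? IH2 [_ [/IH1 v1 /IH2 v2]]; apply: valid_ImpL.
- by move=> Γ Δ A B ? IH [fit /IH]; apply: valid_ImpR.
- by move=> Γ Δ A t ? IH [_ /IH]; apply: valid_AllL.
- by move=> Γ Δ A a ev ? IH [fit /IH]; apply: valid_AllR.
- by move=> Γ Δ A a ev ? IH [_ /IH]; apply: valid_ExL.
- by move=> Γ Δ A t ? IH [_ /IH]; apply: valid_ExR.
- by move=> Γ Δ F v r s _ _ ? IH [_ /IH]; apply: valid_EqR; left.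
- by move=> Γ Δ F v r s _ _ ? IH [_ /IH]; apply: valid_EqR; right.
- by move=> Γ Δ F v r s _ _ ? IH [_ /IH]; apply: valid_EqL; left.
- by move=> Γ Δ F v r s _ _ ? IH [_ /IH]; apply: valid_EqL; right.
Qed.

(** ** Completeness *)

Fixpoint fsize n (A : formula L n) : nat :=
  match A with
  | Rel _ _ | Eq _ _ => 0
  | Not B | All B | Ex B => (fsize B).+1
  | And B C | Or B C | Imp B C => (maxn (fsize B) (fsize C)).+1
  end.

Lemma fsize_fbind m n (τ : 'I_m -> term L n) A : fsize (fbind τ A) = fsize A.
Proof. by elim: A n τ => //= *; congruence. Qed.

Local Notation holds A := (force Free ρ0 A).

Lemma test_right A : test ([::], [:: A]).
Proof. by rewrite /test /fits; case: c. Qed.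

Lemma world_left Γ : world (Γ, [::]).
Proof. by rewrite /world; case: c. Qed.

Local Hint Resolve test_right world_left : core.

Lemma fresh_position k (A : formula L 1) : exists a,
  [/\ ~ soccurs a k.1, ~ soccurs a k.2 & ~ foccurs a A].
Proof.
have [N1 H1] := fresh_for k.1; have [N2 H2] := fresh_for k.2.
have [N3 H3] := fresh_for [:: All A].
exists (maxn N1 (maxn N2 N3)); split.
- by apply: H1; rewrite leq_maxl.
- by apply: H2; rewrite !leq_max leqnn orbT.
- by move=> occ; apply: (H3 (maxn N1 (maxn N2 N3)));
    [rewrite !leq_max leqnn !orbT | left].
Qed.

Lemma holds_inst (A : formula L 1) t :
  holds (inst A t) = force Free (scons t ρ0) A.
Proof. by rewrite force_inst ev_Free. Qed.

Ltac prov_from h :=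
  apply: (provable_incl _ _ _ h); 
    [first [by auto | exact: world_test | by apply: test_join; auto]
    | solve_incl | solve_incl].

Lemma world_succ w B : world w -> fits (w.2 ++ [:: B]).
Proof. by move=> ww; apply: (test_join ww (test_right B)). Qed.

Local Hint Resolve world_succ : core.

Lemma bot_left A k : bot (([:: A], [::]) ⊗ k) <-> provable prec c (k.1 ++ [:: A]) k.2.
Proof.
by split=> h; apply: (provable_incl (provable_fits h) _ _ h); solve_incl.
Qed.

Lemma bot_right A w : bot (w ⊗ ([::], [:: A])) <-> provable prec c w.1 (w.2 ++ [:: A]).
Proof. by rewrite /bot /= cats0. Qed.

(** The two halves are Okada's conditions: identity axioms hold in the model, and
    forcing implies provability. *)
Definition adequate A :=
  holds A ([:: A], [::]) /\ refutes ([::], [:: A]) (holds A).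

Lemma adequate_left A k : adequate A -> refutes k (holds A) ->
  provable prec c (k.1 ++ [:: A]) k.2.
Proof. by move=> [A1 _] ref; apply/bot_left/ref. Qed.

Lemma adequate_right A w : adequate A -> world w -> holds A w ->
  provable prec c w.1 (w.2 ++ [:: A]).
Proof. by move=> [_ A2] ww Aw; apply/bot_right/A2. Qed.

Lemma holds_left A B : (forall k, test k -> refutes k (holds A) ->
    provable prec c (k.1 ++ [:: B]) k.2) -> holds A ([:: B], [::]).
Proof. by move=> h; apply: force_closed => // k tk /(h _ tk)/bot_left. Qed.

Lemma adequate_atom P : holds P = atom P -> adequate P.
Proof.
move=> hP; rewrite /adequate hP; split.
  by apply: cl_unit; auto; apply: derives_ax; left.
move=> w ww Pw; apply: Pw => // w' ww' Pw'.
by have h := derives_provable c prec_asym Pw'; prov_from h.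
Qed.

(** The induction is on the size of [A], since the instances of a quantified
    formula are not subformulae.  For each connective the first half is the left
    rule and the second half the right rule. *)
Theorem adequacy A : adequate A.
Proof.
have [m] := ubnP (fsize A); elim: m A => // m IH A; rewrite ltnS.
case: A => [p ts|t u|B|B C|B C|B C|B|B] /= le.
- apply: adequate_atom => /=; congr (atom (Rel p _)).
  by apply: functional_extensionality => i; apply: ev_Free.
- by apply: adequate_atom; rewrite /= !ev_Free.
- have aB := IH B le; split.
    by move=> w ww /(adequate_right aB ww) Bw; apply/bot_left/provable_NotL.
  move=> w ww /(_ _ (world_left _) aB.1) h.
  apply/bot_right/provable_NotR; auto.
  by prov_from h.
all: move: le; rewrite ?gtn_max.
- case/andP => /IH aB /IH aC; split.
    split; apply: holds_left => k tk.
      by move/(adequate_left aB); apply: provable_AndL1.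
    by move/(adequate_left aC); apply: provable_AndL2.
  move=> w ww [/(adequate_right aB ww) Bw /(adequate_right aC ww) Cw].
  exact/bot_right/provable_AndR.
- case/andP => /IH aB /IH aC; split.
    apply: holds_left => k tk ref; apply: provable_OrL.
      apply: adequate_left => // w ww Bw.
      by apply: ref => //; apply: cl_unit => //; left.
    apply: adequate_left => // w ww Cw.
    by apply: ref => //; apply: cl_unit => //; right.
  move=> w ww; apply; auto => w' ww' [Bw'|Cw']; apply/bot_right.
    exact/provable_OrR1/adequate_right.
  exact/provable_OrR2/adequate_right.
- case/andP => /IH aB /IH aC; split.
    move=> w ww /(adequate_right aB ww) Bw; apply: force_closed; auto.
    move=> k tk /(adequate_left aC) Ck.
    by have h := provable_ImpL Bw Ck; prov_from h.
  move=> w ww /(_ _ (world_left _) aB.1) h; apply/bot_right/provable_ImpR.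
  have {}h := adequate_right aC (world_join ww (world_left _)) h.
  by move: h; rewrite /= cats0.
- move=> le; split.
    move=> t; rewrite -holds_inst; apply: holds_left => k tk ref.
    apply: (@provable_AllL _ _ _ _ _ _ t); apply: adequate_left ref.
    by apply: IH; rewrite fsize_fbind.
  move=> w ww Bw; have [a [aw1 aw2 aB]] := fresh_position w B.
  apply/bot_right/(@provable_AllR _ _ _ _ _ _ a).
    by split=> //=; rewrite soccurs_cat /=; tauto.
  by apply: adequate_right; rewrite ?holds_inst //; apply: IH; rewrite fsize_fbind.
- move=> le; split.
    apply: holds_left => k tk ref; have [a [ak1 ak2 aB]] := fresh_position k B.
    apply: (@provable_ExL _ _ _ _ _ _ a).
      by split=> //=; rewrite soccurs_cat /=; tauto.
    apply: adequate_left; first by apply: IH; rewrite fsize_fbind.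
    rewrite holds_inst => w ww Bw; apply: ref => //; apply: cl_unit => //.
    by exists (Free a).
  move=> w ww; apply; auto => w' ww' [t Bw'].
  have {}Bw' : holds (inst B t) w' by rewrite holds_inst.
  apply/bot_right/(@provable_ExR _ _ _ _ _ _ t).
  by apply: adequate_right => //; apply: IH; rewrite fsize_fbind.
Qed.

Theorem valid_provable Γ Δ : fits Δ -> valid Γ Δ -> provable prec c Γ Δ.
Proof.
move=> fit v; have h : bot ((Γ, [::]) ⊗ ([::], Δ)).
  apply: (v Free) => //.
    move=> A inA; apply: (force_mono _ _ _ _ (adequacy A).1) => //.
    by move=> B /= [<-|].
  move=> B inB w ww /((adequacy B).2 w ww) h.
  apply: (bot_incl _ _ _ h); first exact: test_join.
    by solve_incl.
  by move=> C /In_cat /= [inC|[<-|//]]; apply/In_cat; auto.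
by move: h; rewrite /bot /= cats0.
Qed.

End Model.

Theorem corollary1p1 (L : language) (prec : term L 0 -> term L 0 -> Prop)
    (prec_asym : forall r s : term L 0, prec r s -> ~ prec s r)
    (c : calculus) (S : sequent L) (d : derivation S)
    (d_in : derivation_in c d) :
  exists d' : derivation S,
    derivation_in c d' /\ cut_free d' /\ semishortening prec d'.
Proof.
have fit : fits c (succedent S).
  by have /everywhere_last := proj1 (derivation_in_fits c d) d_in.
have v := @soundness _ prec _ _ _ d_in.
case: S d d_in fit v => Γ Δ d _ fit v.
exact: provable_derivation (valid_provable prec_asym fit v).
Qed.
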